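(* Let $f$ be any function with property $P^{\ast}$ and let $n\geq 6$. If $G$ is a bicyclic graph of order $n$ not isomorphic to any of $B_1,B_2,B_3,B_4$, then $\rho(A_f(G))<\rho(A_f(B_3))$.
   Context: All graphs are simple and connected; $d_i$ is the degree of $v_i$. A function $f(x,y)$ (positive, symmetric, twice differentiable in $x$) has property $P^{\ast}$ if $f>0$, $f'_x\geq 0$, $f''_x\geq 0$, and whenever $x_1+y_1=x_2+y_2$ and $|x_1-y_1|>|x_2-y_2|$ we have $f(x_1,y_1)\geq f(x_2,y_2)$. $A_f(G)$ has $(i,j)$-entry $f(d_i,d_j)$ if $v_iv_j\in E(G)$ and $0$ otherwise; $\rho(A_f(G))$ is its largest eigenvalue. A bicyclic graph is a connected graph with $|E|=|V|+1$. The diamond is $K_4$ minus an edge; call its two adjacent degree-3 vertices $u,v$ and its two nonadjacent degree-2 vertices $a,b$. The graphs (all of order $n$): $B_1$ is the diamond with $n-4$ pendant vertices attached to $u$; $B_2$ consists of two triangles sharing exactly one vertex $c$, with $n-5$ pendant vertices attached to $c$; $B_3$ is the diamond with $n-5$ pendant vertices attached to $u$ and one pendant vertex attached to $v$; $B_4$ is the diamond with $n-4$ pendant vertices attached to $a$. *)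

(* Defs.v *)
From HB Require Import structures.
From mathcomp Require Import all_boot all_order all_algebra perm.
From mathcomp Require Import all_classical all_reals all_analysis.
Set Implicit Arguments. Unset Strict Implicit. Unset Printing Implicit Defensive.
Import Order.TTheory GRing.Theory Num.Theory.
Local Open Scope ring_scope.

(* Property P* of f (degrees are positive, so all conditions are required on
   positive arguments). *)
Definition propP (R : realType) (f : R -> R -> R) : Prop :=
  (forall x y, 0 < x -> 0 < y -> 0 < f x y) /\
  (forall x y, 0 < x -> 0 < y -> f x y = f y x) /\
  (forall y x, 0 < x -> 0 < y ->
     derivable (fun t => f t y) x 1 /\
     derivable (derive1 (fun t => f t y)) x 1 /\
     0 <= derive1 (fun t => f t y) x /\
     0 <= derive1 (derive1 (fun t => f t y)) x) /\
  (forall x1 y1 x2 y2, 0 < x1 -> 0 < y1 -> 0 < x2 -> 0 < y2 ->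
     x1 + y1 = x2 + y2 -> `|x1 - y1| > `|x2 - y2| -> f x1 y1 >= f x2 y2).

Definition simple_graph n (e : rel 'I_n) : Prop := irreflexive e /\ symmetric e.
Definition connected_graph n (e : rel 'I_n) : Prop := forall i j, connect e i j.
Definition num_edges n (e : rel 'I_n) : nat :=
  #|[set p : 'I_n * 'I_n | e p.1 p.2 && (p.1 < p.2)%N]|.
Definition bicyclic n (e : rel 'I_n) : Prop :=
  simple_graph e /\ connected_graph e /\ num_edges e = n.+1.
Definition deg n (e : rel 'I_n) (i : 'I_n) : nat := #|[set j | e i j]|.
Definition isomorphic n (e1 e2 : rel 'I_n) : Prop :=
  exists s : {perm 'I_n}, forall i j, e1 (s i) (s j) = e2 i j.

Definition Af (R : realType) (f : R -> R -> R) n (e : rel 'I_n) : 'M[R]_n :=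
  \matrix_(i, j) (if e i j then f (deg e i)%:R (deg e j)%:R else 0).

Definition largest_eigenvalue (R : realType) n (A : 'M[R]_n) (r : R) : Prop :=
  eigenvalue A r /\ (forall s, eigenvalue A s -> s <= r).

(* The extremal graphs, with vertices 0..n-1.  Diamond: u = 0, v = 1, a = 2,
   b = 3 (edges uv, ua, ub, va, vb). *)
Definition sym_rel (n : nat) (a : nat -> nat -> bool) : rel 'I_n :=
  fun i j => a i j || a j i.
Arguments sym_rel : clear implicits.
Definition diamond_adj (i j : nat) : bool :=
  [|| (i == 0) && (j == 1), (i == 0) && (j == 2), (i == 0) && (j == 3),
      (i == 1) && (j == 2) | (i == 1) && (j == 3)]%N.
(* B1: n-4 pendants (4..n-1) at u *)
Definition B1 n : rel 'I_n :=
  sym_rel n (fun i j => diamond_adj i j || (i == 0)%N && (4 <= j)%N).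
(* B2: triangles {0,1,2}, {0,3,4} sharing c = 0; n-5 pendants (5..n-1) at c *)
Definition B2 n : rel 'I_n :=
  sym_rel n (fun i j => [|| (i == 0) && (j == 1), (i == 0) && (j == 2),
    (i == 1) && (j == 2), (i == 0) && (j == 3), (i == 0) && (j == 4),
    (i == 3) && (j == 4) | (i == 0) && (5 <= j)]%N).
(* B3: one pendant (4) at v, n-5 pendants (5..n-1) at u *)
Definition B3 n : rel 'I_n :=
  sym_rel n (fun i j => [|| diamond_adj i j, (i == 1) && (j == 4)
    | (i == 0) && (5 <= j)]%N).
(* B4: n-4 pendants (4..n-1) at a = 2 *)
Definition B4 n : rel 'I_n :=
  sym_rel n (fun i j => diamond_adj i j || (i == 2)%N && (4 <= j)%N).
Arguments B1 : clear implicits. Arguments B2 : clear implicits.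
Arguments B3 : clear implicits. Arguments B4 : clear implicits.

(* Main.v *)
Require Import Defs.
From HB Require Import structures.
From mathcomp Require Import all_boot all_order all_algebra perm.
From mathcomp Require Import all_classical all_reals all_analysis.
From mathcomp Require Import ring lra zify.
Import Order.TTheory GRing.Theory Num.Theory.
Import numFieldNormedType.Exports.
Local Open Scope ring_scope.
Set Implicit Arguments. Unset Strict Implicit. Unset Printing Implicit Defensive.

(* The bicyclic graphs other than [B1] and [B2] are those of maximum degree at
   most [n - 2]; let [M] maximise the spectral radius among these.  The Kelmans
   transformation moves all private neighbours of [v] to [u].  By convexity and
   the spreading condition on [f] it strictly increases the radius when the
   Perron vector satisfies [x v <= x u], so in [M] it is only available when it
   disconnects the graph or creates a vertex of degree [n - 1].  This forces
   [M] to be [B4] or a diamond [c, v, a, b] with pendant vertices at [c] and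
   [v]; in the latter case convexity allows moving all but one pendant vertex
   to one side, which gives [B3].  Finally the radius of [B4] is at most that
   of [B3]: a rearrangement of the Perron vector of [B4] has a larger quadratic
   form on [B3]. *)

(** * Quadratic forms of symmetric matrices *)

(** The obstacle is that moving an edge changes two degrees, hence the weights of all edges at both
    vertices, including those that stay. For an edge [u v] the degree sum is preserved, which is
    what the spreading condition controls; at a common neighbour the gain at [u] must pay for the
    loss at [v], which is what convexity controls. Private neighbours of [v] are the only place
    where the choice of the moved set matters. Since [f] is only weakly monotone, strictness cannot
    come from [f]. It comes from the eigenvector equation at [u]: if the radius did not grow, the
    old Perron vector would be an eigenvector of the new graph too, although row [u] has gained a
    positive term. Both [B3] and [B4] have maximum degree exactly n - 2, so both lie in the class
    over which the maximum is taken. Every graph attaining the maximum is one of them, so any other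
    graph of the class is strictly below the maximum, and the weak comparison of [B4] with [B3]
    suffices at the end. *)

Section QuadraticForm.
Context {R : realType} {n : nat}.
Implicit Types (A : 'M[R]_n) (x y z : 'I_n -> R) (r : R).

Definition qform A x : R := \sum_i \sum_j A i j * x i * x j.
Definition sqnorm x : R := \sum_i x i ^+ 2.
(** The zero vector is allowed; nonvanishing is asked for separately where it matters. *)
Definition is_eigen A r x := forall i, \sum_j A i j * x j = r * x i.

Lemma sqnorm_ge0 x : 0 <= sqnorm x.
Proof. by apply: sumr_ge0 => i _; exact: sqr_ge0. Qed.

Lemma sqnorm_gt0 x i : x i != 0 -> 0 < sqnorm x.
Proof.
move=> xi; rewrite /sqnorm (bigD1 i) //= ltr_wpDr //.
  by apply: sumr_ge0 => j _; exact: sqr_ge0.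
by rewrite lt0r sqr_ge0 sqrf_eq0 xi.
Qed.

Lemma qform_eigen A r x : is_eigen A r x -> qform A x = r * sqnorm x.
Proof.
move=> ex; rewrite /qform /sqnorm mulr_sumr; apply: eq_bigr => i _.
under eq_bigr => j _ do rewrite mulrAC.
by rewrite -mulr_suml ex; ring.
Qed.

Lemma qformD A x y t : A^T = A ->
  qform A (fun i => x i + t * y i) =
  qform A x + 2 * t * (\sum_i y i * \sum_j A i j * x j) + t ^+ 2 * qform A y.
Proof.
move=> sA.
have sAE i j : A i j = A j i by rewrite -[in RHS]sA mxE.
have sw : \sum_i \sum_j A i j * x i * y j = \sum_i y i * \sum_j A i j * x j.
  rewrite exchange_big /=; apply: eq_bigr => i _; rewrite mulr_sumr.
  by apply: eq_bigr => j _; rewrite sAE; ring.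
rewrite (_ : 2 * t * _ = t * (\sum_i \sum_j A i j * x i * y j)
    + t * (\sum_i y i * \sum_j A i j * x j)); last by rewrite sw; ring.
rewrite /qform !mulr_sumr -!big_split /=; apply: eq_bigr => i _.
rewrite !mulr_sumr -!big_split /=; apply: eq_bigr => j _; ring.
Qed.

(* A maximiser of the Rayleigh quotient is an eigenvector: perturb it in the
   direction of the residual [A x - r x]. *)
Lemma maximizer_eigen A r x : A^T = A ->
  (forall z, qform A z <= r * sqnorm z) -> qform A x = r * sqnorm x ->
  is_eigen A r x.
Proof.
move=> sA rA Ax.
pose d i := \sum_j A i j * x j - r * x i.
pose K := r * sqnorm d - qform A d.
have K0 : 0 <= K by rewrite subr_ge0.
have H t : 2 * t * sqnorm d <= t ^+ 2 * K.
  have := rA (fun i => x i + t * d i); rewrite qformD // Ax.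
  have -> : sqnorm (fun i => x i + t * d i) =
      sqnorm x + 2 * t * (\sum_i d i * x i) + t ^+ 2 * sqnorm d.
    rewrite /sqnorm !mulr_sumr -!big_split /=; apply: eq_bigr => i _; ring.
  have dE : \sum_i d i * (\sum_j A i j * x j) = sqnorm d + r * \sum_i d i * x i.
    rewrite /sqnorm mulr_sumr -big_split /=; apply: eq_bigr => i _.
    have -> : \sum_j A i j * x j = d i + r * x i by rewrite /d subrK.
    by ring.
  by rewrite dE /K; clear; lra.
have d0 : sqnorm d = 0.
  apply/eqP; rewrite eq_le sqnorm_ge0 andbT leNgt; apply/negP => dpos.
  (* The linear term in [t] dominates for small [t]. Dividing by [K + 1] rather than [K] covers
     [K = 0], and [K / (K + 1) < 2] then gives the contradiction. *)
  have := H (sqnorm d / (K + 1)).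
  have K1 : 0 < K + 1 by rewrite ltr_wpDl.
  have KN : K + 1 != 0 by rewrite gt_eqF.
  have -> : 2 * (sqnorm d / (K + 1)) * sqnorm d = (sqnorm d) ^+ 2 / (K + 1) * 2.
    by field.
  have -> : (sqnorm d / (K + 1)) ^+ 2 * K = (sqnorm d) ^+ 2 / (K + 1) * (K / (K + 1)).
    by field.
  have : 0 < sqnorm d ^+ 2 / (K + 1) by rewrite divr_gt0 // exprn_gt0.
  have : K / (K + 1) < 2 by rewrite ltr_pdivrMr //; clear -K0; lra.
  by clear; nra.
move=> i; apply/eqP; rewrite -subr_eq0; apply/negP => /negP di.
by have := @sqnorm_gt0 d i di; rewrite d0 ltxx.
Qed.

End QuadraticForm.

(** [eigenvalue] is stated with row vectors multiplied from the left; symmetry turns them into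
    solutions of [is_eigen]. *)
Lemma eigenvalue_is_eigen (R : realType) n (A : 'M[R]_n) r : A^T = A ->
  eigenvalue A r <-> exists2 x, is_eigen A r x & exists i, x i != 0.
Proof.
move=> sA; have sAE i j : A i j = A j i by rewrite -[in RHS]sA mxE.
split=> [/eigenvalueP[v vA v0]|[x ex [i xi]]].
  exists (fun i => v 0 i) => [i|].
    have := congr1 (fun w : 'rV[R]_n => w 0 i) vA; rewrite !mxE => <-.
    by apply: eq_bigr => j _; rewrite sAE mulrC.
  by case/rV0Pn: v0 => i vi; exists i.
apply/eigenvalueP; exists (\row_i x i).
  apply/rowP => j; rewrite !mxE -ex; apply: eq_bigr => k _.
  by rewrite mxE sAE mulrC.
by apply/rV0Pn; exists i; rewrite mxE.
Qed.

(** The form attains its maximum on the compact unit sphere, homogeneity extends the bound to all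
    vectors, and a maximiser is an eigenvector. The dimension is a successor so that the sphere is
    nonempty. *)
Lemma qform_le_max (R : realType) n (A : 'M[R]_n.+1) : A^T = A ->
  exists r x, [/\ exists i, x i != 0, is_eigen A r x &
    forall z, qform A z <= r * sqnorm z].
Proof.
move=> sA.
pose S : set 'rV[R]_n.+1 := [set v | sqnorm (v 0) = 1]%classic.
have csum m (g : 'I_m -> 'rV[R]_n.+1 -> R) :
    (forall i, continuous (g i)) -> continuous (fun v => \sum_i g i v).
  by move=> cg; apply: continuous_big => //; exact: add_continuous.
have cc (i : 'I_n.+1) : continuous (fun v : 'rV[R]_n.+1 => v 0 i).
  exact: coord_continuous.
have cn : continuous (fun v : 'rV[R]_n.+1 => sqnorm (v 0)).
  by apply: (csum) => i v; exact: (continuousM (cc i v) (cc i v)).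
have cq : continuous (fun v : 'rV[R]_n.+1 => qform A (v 0)).
  apply: (csum) => i; apply: (csum) => j v.
  have cA : {for v, continuous (cst (A i j) : 'rV[R]_n.+1 -> R)} by exact: cst_continuous.
  exact: (continuousM (continuousM cA (cc i v)) (cc j v)).
have Sc : compact S.
  apply: bounded_closed_compact.
    exists 1; split=> // M M1 v /= Sv; apply: le_trans (ltW M1).
    rewrite /Num.norm /= mx_normrE; apply/bigmax_leP; split=> //= -[i j] _ /=.
    rewrite ord1 -(@ler_pXn2r _ 2) ?nnegrE // expr1n real_normK ?num_real //.
    rewrite -Sv /sqnorm (bigD1 j) //= lerDl.
    by apply: sumr_ge0 => k _; exact: sqr_ge0.
  rewrite (_ : S = (fun v => sqnorm (v 0)) @^-1` [set 1])%classic //.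
  by apply: closed_comp => [v _|]; [exact: cn | exact: closed_eq].
have S0 : (S !=set0)%classic.
  exists (delta_mx 0 0); rewrite /S /= /sqnorm (bigD1 0) //= big1 => [|i i0].
    by rewrite !mxE !eqxx expr1n addr0.
  by rewrite mxE (negPf i0) expr0n.
have [c cS cmax] := @EVT_max_rV _ _ (fun v => qform A (v 0)) S S0 Sc
  (continuous_subspaceT cq).
rewrite in_setE in cS.
have hom t z : qform A (fun i => t * z i) = t ^+ 2 * qform A z.
  rewrite /qform mulr_sumr; apply: eq_bigr => i _.
  by rewrite mulr_sumr; apply: eq_bigr => j _; ring.
have homn t z : sqnorm (fun i : 'I_n.+1 => t * z i) = t ^+ 2 * sqnorm z.
  by rewrite /sqnorm mulr_sumr; apply: eq_bigr => i _; ring.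
have rmax z : qform A z <= qform A (c 0) * sqnorm z.
  have [z0|zN] := eqVneq (sqnorm z) 0.
    have zi i : z i = 0.
      by apply/eqP; apply: contraT => /sqnorm_gt0; rewrite z0 ltxx.
    rewrite z0 mulr0 /qform big1 // => i _; rewrite big1 // => j _.
    by rewrite (zi j) mulr0.
  have s0 : 0 < sqnorm z by rewrite lt0r zN sqnorm_ge0.
  set s := Num.sqrt (sqnorm z).
  have ss : s ^+ 2 = sqnorm z by rewrite sqr_sqrtr // ltW.
  have sN : s ^+ 2 != 0 by rewrite ss.
  have := cmax (\row_i (s^-1 * z i)).
  have -> : (\row_i (s^-1 * z i)) 0 = (fun i => s^-1 * z i) :> ('I_n.+1 -> R).
    by apply/funext => i; rewrite mxE.
  rewrite hom exprVn => H.
  rewrite -ss -ler_pdivrMr ?ss // mulrC -ss; apply: H.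
  rewrite in_setE /S /=.
  have -> : (\row_i (s^-1 * z i)) 0 = (fun i => s^-1 * z i) :> ('I_n.+1 -> R).
    by apply/funext => i; rewrite mxE.
  by rewrite homn exprVn -ss mulVf.
exists (qform A (c 0)), (c 0); split=> //.
  apply: contrapT => /forallNP c0; move: cS; rewrite /S /= /sqnorm big1.
    by move/eqP; rewrite eq_sym oner_eq0.
  by move=> i _; have /negP := c0 i; rewrite negbK => /eqP ->; rewrite expr0n.
apply: maximizer_eigen => //.
by have -> : sqnorm (c 0) = 1 by []; rewrite mulr1.
Qed.

(** * Consequences of property P* *)

Section PositiveHalfLine.
Context {R : realType} (g : R -> R).
Hypothesis dg : forall x, 0 < x -> derivable g x 1.

Lemma pos_MVT a b : 0 < a -> a <= b ->
  exists2 c, c \in `[a, b]%R & g b - g a = derive1 g c * (b - a).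
Proof.
move=> a0 ab; apply: MVT_segment => // [x|].
  move=> /[!in_itv] /= /andP[ax _]; rewrite derive1E; apply: derivableP.
  by apply: dg; exact: lt_trans ax.
apply: derivable_within_continuous => x /[!in_itv] /= /andP[ax _].
by apply: dg; exact: lt_le_trans ax.
Qed.

Lemma pos_derive1_ge0_le a b : (forall x, 0 < x -> 0 <= derive1 g x) ->
  0 < a -> a <= b -> g a <= g b.
Proof.
move=> dg0 a0 ab; have [c /[!in_itv] /= /andP[ac _] e] := pos_MVT a0 ab.
by rewrite -subr_ge0 e mulr_ge0 ?subr_ge0 // dg0 // (lt_le_trans a0).
Qed.

Lemma pos_convex_incr a b k :
  (forall x y, 0 < x -> x <= y -> derive1 g x <= derive1 g y) ->
  0 < a -> a <= b -> 0 <= k -> g (a + k) - g a <= g (b + k) - g b.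
Proof.
move=> mg a0 ab k0.
have H p q r s : 0 < p -> p <= q -> q <= r -> r <= s -> q - p = s - r ->
    g q - g p <= g s - g r.
  move=> p0 pq qr rs e.
  have [c /[!in_itv] /= /andP[pc cq] ->] := pos_MVT p0 pq.
  have [d /[!in_itv] /= /andP[rd ds] ->] := pos_MVT (lt_le_trans p0 (le_trans pq qr)) rs.
  rewrite e ler_wpM2r ?subr_ge0 // mg ?(lt_le_trans p0) //.
  by rewrite (le_trans cq) // (le_trans qr).
have [akb|bak] := leP (a + k) b.
  by apply: H => //; lra.
(* When the two intervals overlap, the claim is equivalent to comparing the increments over [[a, b]]
   and [[a + k, b + k]], which have equal length and are separated. *)
have : g b - g a <= g (b + k) - g (a + k) by apply: H; lra.
lra.
Qed.

End PositiveHalfLine.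

Section PropP.
Context {R : realType} (f : R -> R -> R).
Hypothesis fP : propP f.
Implicit Types a b c d k y : nat.

Definition fnat a b : R := f a%:R b%:R.

Lemma fnat_gt0 a b : (0 < a)%N -> (0 < b)%N -> 0 < fnat a b.
Proof. by case: fP => h _ ? ?; apply: h; rewrite ltr0n. Qed.

Lemma fnatC a b : (0 < a)%N -> (0 < b)%N -> fnat a b = fnat b a.
Proof. by case: fP => _ [h _] ? ?; apply: h; rewrite ltr0n. Qed.

Lemma fnat_le a b y : (0 < a)%N -> (0 < y)%N -> (a <= b)%N -> fnat a y <= fnat b y.
Proof.
move=> a0 y0 ab; case: fP => _ [_ [h _]].
apply: (@pos_derive1_ge0_le _ (f^~ y%:R)); rewrite ?ltr0n ?ler_nat //.
  by move=> x x0; have [] := h y%:R x x0; rewrite ?ltr0n.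
by move=> x x0; have [] := h y%:R x x0; rewrite ?ltr0n // => _ [_ []].
Qed.

Lemma fnat_convex a b k y : (0 < a)%N -> (0 < y)%N -> (a <= b)%N ->
  fnat (a + k) y + fnat b y <= fnat (b + k) y + fnat a y.
Proof.
move=> a0 y0 ab; case: fP => _ [_ [h _]].
have y0' : 0 < y%:R :> R by rewrite ltr0n.
have h' x (x0 : 0 < x) := h y%:R x x0 y0'.
have := @pos_convex_incr _ (f^~ y%:R) _ a%:R b%:R k%:R.
rewrite /fnat !natrD => H.
suff: f (a%:R + k%:R) y%:R - f a%:R y%:R <= f (b%:R + k%:R) y%:R - f b%:R y%:R by lra.
apply: H; rewrite ?ltr0n ?ler0n ?ler_nat //.
  by move=> x /h'[].
move=> p q p0 pq; apply: (@pos_derive1_ge0_le _ (derive1 (f^~ y%:R))) => //.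
  by move=> x /h'[_ []].
by move=> x /h'[_ [_ []]].
Qed.

(** Each of the [k] unit increments from [a] to [a + k] is at most the next one, from [a + k] to
    [a + k + 1]. This lets the gain of [k] moved pendant vertices pay for the loss at one that
    stays. *)
Lemma fnat_convex_mul a k y : (0 < a)%N -> (0 < y)%N ->
  fnat (a + k) y - fnat a y <= k%:R * (fnat (a + k).+1 y - fnat (a + k) y).
Proof.
move=> a0 y0; elim: k => [|k IH]; first by rewrite addn0 subrr mul0r.
have k0 : 0 <= k%:R :> R by rewrite ler0n.
have := @fnat_convex (a + k) (a + k.+1) 1 y.
rewrite addn_gt0 a0 => /(_ isT y0); rewrite leq_add2l leqnSn !addn1 !addnS => /(_ isT) h.
rewrite -natr1 mulrDl mul1r.
have : k%:R * (fnat (a + k).+1 y - fnat (a + k) y) <=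
    k%:R * (fnat (a + k).+2 y - fnat (a + k).+1 y).
  by rewrite ler_wpM2l //; move: h; lra.
by move: h IH; lra.
Qed.

(** The spreading condition requires a strictly larger gap. The two boundary cases, where the pairs
    coincide up to order, follow from reflexivity and the symmetry of [f]. *)
Lemma fnat_spread a b c d : (0 < a)%N -> (0 < b)%N -> (0 < d)%N ->
  (a + b = c + d)%N -> (a <= c)%N -> (b <= c)%N -> fnat a b <= fnat c d.
Proof.
move=> a0 b0 d0 e ac bc.
have c0 : (0 < c)%N by lia.
have [ac'|ca] := eqVneq a c.
  have -> : b = d by lia.
  by rewrite ac'.
have [bc'|cb] := eqVneq b c.
  have -> : a = d by lia.
  by rewrite bc' fnatC.
case: fP => _ [_ [_ h]]; apply: h; rewrite ?ltr0n // -?natrD ?e //.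
have -> : c%:R - d%:R = (c - d)%:R :> R by rewrite natrB //; lia.
rewrite (@ger0_norm _ (c - d)%:R) ?ler0n // ltr_norml.
apply/andP; split.
  by rewrite ltrBrDr addrC ltrBlDr -natrD ltr_nat; lia.
by rewrite ltrBlDr -natrD ltr_nat; lia.
Qed.

End PropP.

(** * Perron vectors of weighted adjacency matrices *)

Section Graphs.
Context {n : nat}.
Implicit Types (e : rel 'I_n) (i j u v w : 'I_n).

Lemma deg_gt0 e i j : e i j -> (0 < deg e i)%N.
Proof. by move=> eij; apply/card_gt0P; exists j; rewrite inE. Qed.

Lemma sum_deg e : simple_graph e -> (\sum_i deg e i = 2 * num_edges e)%N.
Proof.
move=> [irr sym].
have -> : num_edges e = (\sum_i \sum_j (e i j && (i < j)))%N.
  rewrite /num_edges -sum1_card big_mkcond pair_big /=.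
  by apply: eq_bigr => -[i j] _; rewrite inE /=; case: (_ && _).
have -> : (\sum_i deg e i = \sum_i \sum_j ((e i j && (i < j)) + (e i j && (j < i))))%N.
  apply: eq_bigr => i _; rewrite /deg -sum1_card big_mkcond; apply: eq_bigr => j _.
  rewrite inE; have [-> |ij] := eqVneq i j; first by rewrite irr.
  by case: ltngtP => [||/val_inj] //; rewrite ?andbT ?andbF; case: (e i j) => //; move/eqP: ij.
under eq_bigr => i _ do rewrite big_split /=.
rewrite big_split /= mul2n -addnn; congr addn.
rewrite exchange_big /=; apply: eq_bigr => i _; apply: eq_bigr => j _.
by rewrite sym.
Qed.

Lemma isomorphic_sym e1 e2 : isomorphic e1 e2 -> isomorphic e2 e1.
Proof.
move=> [s h]; exists (s^-1)%g => i j.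
by rewrite -h !permKV.
Qed.

Lemma deg_iso e1 e2 (s : {perm 'I_n}) :
  (forall i j, e1 (s i) (s j) = e2 i j) -> forall i, deg e1 (s i) = deg e2 i.
Proof.
move=> h i; rewrite /deg -(card_imset [set j | e2 i j] (@perm_inj _ s)).
apply: eq_card => j; rewrite inE; apply/idP/imsetP => [ej|[k]].
  by exists ((s^-1)%g j); rewrite ?permKV // inE -h permKV.
by rewrite inE => ek ->; rewrite h.
Qed.

End Graphs.

Lemma largest_eigenvalue_unique (R : realType) n (A : 'M[R]_n) r s :
  largest_eigenvalue A r -> largest_eigenvalue A s -> r = s.
Proof. by move=> [er mr] [es ms]; apply/le_anti; rewrite mr // ms. Qed.

Section Spectrum.
Context {R : realType} (f : R -> R -> R).
Hypothesis fP : propP f.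
Context {n : nat}.
Implicit Types (e : rel 'I_n).

Lemma AfE e i j : Af f e i j = if e i j then fnat f (deg e i) (deg e j) else 0.
Proof. by rewrite mxE. Qed.

Lemma Af_gt0 e i j : symmetric e -> e i j -> 0 < Af f e i j.
Proof.
move=> sym eij; rewrite AfE eij fnat_gt0 //; first exact: deg_gt0 eij.
by rewrite sym in eij; exact: deg_gt0 eij.
Qed.

Lemma Af_ge0 e i j : symmetric e -> 0 <= Af f e i j.
Proof.
by move=> sym; have [/Af_gt0/ltW -> //|/negPf eij] := boolP (e i j); rewrite AfE eij.
Qed.

Lemma Af_tr e : symmetric e -> (Af f e)^T = Af f e.
Proof.
move=> sym; apply/matrixP => i j; rewrite mxE !AfE sym.
case: ifP => // eij; rewrite fnatC //; last exact: deg_gt0 eij.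
by rewrite sym in eij; exact: deg_gt0 eij.
Qed.

(** The Rayleigh bound is kept alongside the eigenvector equation, since radii are bounded from
    below by evaluating the form at a test vector from another graph. *)
Definition perron_pair e r x := [/\ forall i, 0 < x i, is_eigen (Af f e) r x &
  forall z, qform (Af f e) z <= r * sqnorm z].

Lemma perron_largest e r x : (0 < n)%N -> symmetric e -> perron_pair e r x ->
  largest_eigenvalue (Af f e) r.
Proof.
move=> n0 sym [x0 ex mx]; split.
  apply/(eigenvalue_is_eigen r (Af_tr sym)); exists x => //.
  by exists (Ordinal n0); rewrite gt_eqF.
move=> s /(eigenvalue_is_eigen s (Af_tr sym))[y ey [i yi]].
by have := mx y; rewrite (qform_eigen ey) ler_pM2r // (sqnorm_gt0 yi).
Qed.

Lemma largest_eigenvalue_iso e1 e2 r : symmetric e1 -> symmetric e2 ->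
  isomorphic e1 e2 -> largest_eigenvalue (Af f e1) r ->
  largest_eigenvalue (Af f e2) r.
Proof.
have H (a b : rel 'I_n) s : symmetric a -> symmetric b -> isomorphic a b ->
    eigenvalue (Af f a) s -> eigenvalue (Af f b) s.
  move=> sa sb [p h] /(eigenvalue_is_eigen s (Af_tr sa))[x ex [i xi]].
  apply/(eigenvalue_is_eigen s (Af_tr sb)); exists (x \o p); last first.
    by exists ((p^-1)%g i); rewrite /= permKV.
  move=> j; rewrite /= -ex [RHS](reindex_inj (@perm_inj _ p)); apply: eq_bigr => k _.
  by rewrite !AfE h !(deg_iso h).
move=> s1 s2 h [er mr]; split; first exact: H er.
by move=> s /(H _ _ _ s2 s1 (isomorphic_sym h)); exact: mr.
Qed.

End Spectrum.

(** Entries being nonnegative, the absolute value of a Rayleigh maximiser is again a maximiser,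
    hence an eigenvector. At a zero of it all terms of the eigenvector equation vanish, so the zero
    set is closed under adjacency; by connectedness it would be everything. *)
Lemma perron_exists (R : realType) (f : R -> R -> R) n (e : rel 'I_n) :
  propP f -> (0 < n)%N -> simple_graph e -> connected_graph e ->
  exists r x, perron_pair f e r x.
Proof.
move=> fP; case: n e => // m e _ [irr sym] con.
have [r [y [[k yk] ey mr]]] := qform_le_max (Af_tr fP sym).
pose x i : R := `|y i|.
have sx : sqnorm x = sqnorm y.
  by apply: eq_bigr => i _; rewrite real_normK // num_real.
have qx : qform (Af f e) x = r * sqnorm x.
  apply/le_anti; rewrite mr /= sx -(qform_eigen ey).
  apply: ler_sum => i _; apply: ler_sum => j _.
  by rewrite (le_trans (ler_norm _)) // !normrM ger0_norm // (Af_ge0 fP).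
have ex := maximizer_eigen (Af_tr fP sym) mr qx.
exists r, x; split=> // i; rewrite lt0r normr_ge0 andbT.
apply/negP => xi.
have cl : fingraph.closed e [pred j | x j == 0].
  apply: (intro_closed (sym_connect_sym sym)).
  move=> a b eab; rewrite !inE => /eqP xa.
  have := ex a; rewrite xa mulr0 => /eqP; rewrite psumr_eq0 => [/allP/(_ b)|c _].
    rewrite mem_index_enum => /(_ isT); rewrite mulf_eq0.
    by rewrite (gt_eqF (Af_gt0 fP sym eab)).
  by rewrite mulr_ge0 ?(Af_ge0 fP) ?normr_ge0.
have := closed_connect cl (con i k); rewrite !inE.
by rewrite xi (normr_eq0 (y k)) (negPf yk).
Qed.

(** * Moving neighbours from one vertex to another *)

Section Shift.
Context {n : nat} (e : rel 'I_n) (u v : 'I_n) (Y : {set 'I_n}).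

(** Each edge [v w] with [w] in [Y] is replaced by [u w]. Leaving [Y] free covers both the full
    Kelmans transformation and the variant that keeps one pendant vertex at [v]. *)
Definition shift : rel 'I_n := fun i j =>
  if (i == u) && (j \in Y) || (j == u) && (i \in Y) then true
  else if (i == v) && (j \in Y) || (j == v) && (i \in Y) then false
  else e i j.

Hypothesis ge : simple_graph e.
Hypothesis uv : u != v.
Hypothesis hY : forall w, w \in Y -> [/\ e v w, ~~ e u w & w != u].

Let irr := ge.1.
Let sym := ge.2.

Let uY : (u \in Y) = false.
Proof. by apply/negP => /hY[_ _]; rewrite eqxx. Qed.
Let vY : (v \in Y) = false.
Proof. by apply/negP => /hY[]; rewrite irr. Qed.
Let vu : (v == u) = false. Proof. by rewrite eq_sym; exact/negbTE. Qed.

Lemma shift_simple : simple_graph shift.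
Proof.
split=> [i|i j]; last first.
  rewrite /shift sym.
  by case: (i == u); case: (j == u); case: (i == v); case: (j == v);
     case: (i \in Y); case: (j \in Y).
rewrite /shift irr !orbb.
by have [->|] := eqVneq i u; rewrite ?uY ?andbF //= ; case: ifP.
Qed.

Lemma shift_uE w : shift u w = (w \in Y) || e u w.
Proof. by rewrite /shift eqxx uY /= ?andbF ?orbF (negPf uv) /=; case: (w \in Y). Qed.

Lemma shift_vE w : shift v w = (w \notin Y) && e v w.
Proof. by rewrite /shift eqxx vY vu /= ?andbF ?orbF; case: (w \in Y). Qed.

Lemma shift_other i w : i != u -> i != v -> w != u -> w != v -> shift i w = e i w.
Proof. by rewrite /shift => /negPf -> /negPf -> /negPf -> /negPf ->. Qed.

Lemma deg_shift_u : deg shift u = (deg e u + #|Y|)%N.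
Proof.
have -> : deg shift u = #|[set j | e u j] :|: Y|.
  by apply: eq_card => j; rewrite !inE shift_uE orbC.
rewrite cardsU (_ : _ :&: _ = finset.set0) ?cards0 ?subn0 //.
apply/setP => j; rewrite !inE; apply/negP => /andP[euj /hY[_]].
by rewrite euj.
Qed.

Lemma deg_shift_v : (deg shift v + #|Y| = deg e v)%N.
Proof.
have -> : deg shift v = #|[set j | e v j] :\: Y|.
  by apply: eq_card => j; rewrite !inE shift_vE.
rewrite cardsD (_ : _ :&: _ = Y) ?subnK //.
  by apply: subset_leq_card; apply/fintype.subsetP => j /hY[]; rewrite inE.
apply/setP => j; rewrite !inE; apply/andP/idP => [[]|jY] //.
by case: (hY jY).
Qed.

Lemma deg_shift_other w : w != u -> w != v -> deg shift w = deg e w.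
Proof.
move=> wu wv; have [wY|wY] := boolP (w \in Y); last first.
  apply: eq_card => j; rewrite !inE /shift (negPf wu) (negPf wv) (negPf wY).
  by rewrite !andbF.
have [evw euw _] := hY wY.
rewrite /deg (cardsD1 u) [RHS](cardsD1 v) !inE.
rewrite /shift eqxx wY (sym w v) evw orbT; congr addn.
apply: eq_card => j; rewrite !inE (negPf wu) (negPf wv) /= !andbT.
have [->|ju] := eqVneq j u; first by rewrite uv /= sym (negPf euw).
by have [->|] := eqVneq j v.
Qed.

Lemma sum_deg_shift : (\sum_i deg shift i = \sum_i deg e i)%N.
Proof.
rewrite (bigD1 u) //= (bigD1 v) ?vu //= [RHS](bigD1 u) //= [in RHS](bigD1 v) ?vu //=.
have -> : (\sum_(i | (i != u) && (i != v)) deg shift i =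
    \sum_(i | (i != u) && (i != v)) deg e i)%N.
  by apply: eq_bigr => i /andP[iu iv]; exact: deg_shift_other.
by rewrite deg_shift_u -deg_shift_v !addnA (addnAC _ #|Y|).
Qed.

(** Only edges from [v] to [Y] are lost, and they are replaced by walks through [u]. The link from
    [u] to [v] survives because neither [v] nor a common neighbour of [u] and [v] belongs to [Y]. *)
Lemma shift_connected : connected_graph e ->
  e u v \/ (exists z, e u z && e v z) -> connected_graph shift.
Proof.
have [irr' sym'] := shift_simple.
move=> con huv i j.
have cuv : connect shift u v.
  case: huv => [euv|[z /andP[euz evz]]].
    by apply: connect1; rewrite shift_uE euv orbT.
  have zY : z \notin Y by apply/negP => /hY[_]; rewrite euz.
  apply: (@connect_trans _ _ z); apply: connect1; first by rewrite shift_uE euz orbT.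
  by rewrite sym' shift_vE zY.
have H a b : e a b -> connect shift a b.
  move=> eab.
  have [/andP[/eqP -> bY]|] := boolP ((a == v) && (b \in Y)).
    rewrite (sym_connect_sym sym'); apply: connect_trans cuv.
    by apply: connect1; rewrite sym' shift_uE bY.
  have [/andP[/eqP -> aY] _|h1 h2] := boolP ((b == v) && (a \in Y)).
    apply: connect_trans cuv.
    by apply: connect1; rewrite sym' shift_uE aY.
  by apply: connect1; rewrite /shift (negPf h1) (negPf h2) eab; case: ifP.
by apply: (connect_sub H); exact: con.
Qed.

End Shift.

(** Meant for the difference of the matrices after and before a shift: all degrees other than those
    of [u] and [v] are unchanged, so the difference lives on these two rows and columns. *)
Lemma qform_two_rows (R : realType) n (D : 'M[R]_n) (u v : 'I_n) (x : 'I_n -> R) :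
  u != v -> D^T = D -> (forall i, D i i = 0) ->
  (forall i j, i != u -> i != v -> j != u -> j != v -> D i j = 0) ->
  qform D x = 2 * (D u v * x u * x v +
    \sum_(w | (w != u) && (w != v)) (D u w * x u + D v w * x v) * x w).
Proof.
move=> uv sD D0 Dz.
have sDE i j : D i j = D j i by rewrite -[in RHS]sD mxE.
have vu : v != u by rewrite eq_sym.
have row i : \sum_j D i j * x i * x j = D i u * x i * x u + D i v * x i * x v +
    \sum_(w | (w != u) && (w != v)) D i w * x i * x w.
  by rewrite (bigD1 u) //= (bigD1 v) //= addrA.
rewrite /qform (eq_bigr _ (fun i _ => row i)) (bigD1 u) //= [X in _ + X](bigD1 v) //=.
rewrite [X in _ + (_ + X)](_ : _ =
    \sum_(w | (w != u) && (w != v)) (D u w * x u + D v w * x v) * x w); last first.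
  apply: eq_bigr => w /andP[wu wv]; rewrite big1 => [|j /andP[ju jv]].
    by rewrite (sDE w u) (sDE w v); ring.
  by rewrite Dz // !mul0r.
have -> : \sum_(w | (w != u) && (w != v)) (D u w * x u + D v w * x v) * x w =
    \sum_(w | (w != u) && (w != v)) D u w * x u * x w +
    \sum_(w | (w != u) && (w != v)) D v w * x v * x w.
  by rewrite -big_split; apply: eq_bigr => w _; rewrite mulrDl.
rewrite !D0 (sDE v u); ring.
Qed.

Section ShiftSpectrum.
Context {R : realType} (f : R -> R -> R).
Hypothesis fP : propP f.
Context {n : nat} (e : rel 'I_n) (u v : 'I_n) (Y : {set 'I_n}).
Hypothesis ge : simple_graph e.
Hypothesis uv : u != v.
Hypothesis hY : forall w, w \in Y -> [/\ e v w, ~~ e u w & w != u].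
Hypothesis Y0 : (0 < #|Y|)%N.
Hypothesis degY : (deg e v <= deg e u + #|Y|)%N.

Let e' := shift e u v Y.
Let D := Af f e' - Af f e.
Let irr := ge.1.
Let sym := ge.2.
Let ge' : simple_graph e' := shift_simple ge hY.
Let DE i j : D i j = Af f e' i j - Af f e i j. Proof. by rewrite !mxE. Qed.
Let degU : deg e' u = (deg e u + #|Y|)%N. Proof. exact: deg_shift_u. Qed.
Let degV : (deg e' v + #|Y| = deg e v)%N. Proof. exact: deg_shift_v. Qed.
Let degO w : w != u -> w != v -> deg e' w = deg e w.
Proof. exact: deg_shift_other. Qed.

Let e'uE w : e' u w = (w \in Y) || e u w. Proof. exact: shift_uE. Qed.
Let e'vE w : e' v w = (w \notin Y) && e v w. Proof. exact: shift_vE. Qed.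
Let e'E i w : i != u -> i != v -> w != u -> w != v -> e' i w = e i w.
Proof. exact: shift_other. Qed.

(** The degrees of [u] and [v] keep their sum, and [degY] makes the new degree of [u] at least both
    old ones, so the pair has spread out. *)
Lemma shift_Duv : 0 <= D u v.
Proof.
rewrite DE !AfE.
have -> : e' u v = e u v.
  by rewrite e'uE; case: (boolP (v \in Y)) => // /hY[]; rewrite irr.
case: ifP => euv; last by rewrite subrr.
have euv' : e' v u.
  rewrite e'vE sym euv andbT; apply/negP => /hY[_ _].
  by rewrite eqxx.
rewrite subr_ge0; have d1 := deg_gt0 euv.
have d2 : (0 < deg e v)%N by rewrite (@deg_gt0 _ _ _ u) // sym.
have d3 := deg_gt0 euv'.
by apply: fnat_spread; rewrite ?degU //; move: degV; lia.
Qed.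

Lemma shift_Du_ge w : w != u -> w != v -> 0 <= D u w.
Proof.
move=> wu wv; rewrite DE !AfE (degO wu wv) e'uE.
case: (boolP (e u w)) => [euw|_]; last first.
  by case: ifP => // h; rewrite subr0; rewrite orbF in h; have [evw _ _] := hY h;
     rewrite ltW // fnat_gt0 // ?degU ?addn_gt0 ?Y0 ?orbT //;
     rewrite sym in evw; exact: deg_gt0 evw.
rewrite orbT subr_ge0; apply: fnat_le => //; first exact: deg_gt0 euw.
  by rewrite sym in euw; exact: deg_gt0 euw.
by rewrite degU leq_addr.
Qed.

Lemma shift_Du_Y w : w \in Y -> D u w = fnat f (deg e u + #|Y|) (deg e w).
Proof.
move=> wY; have [evw euw wu] := hY wY.
have wv : w != v by apply/eqP => wv; move: evw; rewrite wv irr.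
by rewrite DE !AfE (degO wu wv) e'uE wY (negPf euw) subr0 degU.
Qed.

Lemma shift_Dv_Y w : w \in Y -> D v w = - fnat f (deg e v) (deg e w).
Proof.
move=> wY; have [evw euw wu] := hY wY.
by rewrite DE !AfE e'vE wY evw sub0r.
Qed.

(** At a common neighbour, both degrees move by [#|Y|]: upwards from [deg e u] at [u], and down to
    the new degree of [v], which is at most [deg e u]. By convexity the gain is at least the loss. A
    vertex not adjacent to [v] only sees the gain at [u]. *)
Lemma shift_D_common w : w != u -> w != v -> ~~ (e v w && ~~ e u w) ->
  0 <= D u w + D v w.
Proof.
move=> wu wv; rewrite negb_and negbK => h.
have [/hY[h1 /negPf h2]|wY] := boolP (w \in Y); first by rewrite h1 h2 in h.
have [evw|evw] := boolP (e v w); last first.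
  rewrite [D v w]DE !AfE e'vE (negPf evw) andbF subrr addr0.
  exact: shift_Du_ge.
rewrite evw /= in h.
have dw : (0 < deg e w)%N by rewrite (@deg_gt0 _ _ _ u) // sym.
have e'vw : e' v w by rewrite e'vE wY.
rewrite !DE !AfE e'vw evw h e'uE h orbT (degO wu wv) degU -degV.
have := @fnat_convex _ _ fP (deg e' v) (deg e u) #|Y| (deg e w) (deg_gt0 e'vw) dw.
by rewrite addrACA -opprD subr_ge0 [leLHS]addrC; apply; move: degV degY; lia.
Qed.

(** The form of the old Perron vector does not decrease: the edge [u v] and all vertices that are
    not private neighbours of [v] contribute nonnegatively by the preceding estimates, and the
    private neighbours are left to the caller as a hypothesis. *)
Lemma shift_rho_lt r x r' : perron_pair f e r x -> x v <= x u ->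
  0 <= \sum_(w | e v w && ~~ e u w && (w != u)) (D u w * x u + D v w * x v) * x w ->
  (forall z, qform (Af f e') z <= r' * sqnorm z) -> r < r'.
Proof.
move=> [x0 ex mx] xvu hP mx'.
have vu : v != u by rewrite eq_sym.
have sD : D^T = D by rewrite /D linearB /= (Af_tr fP sym) (Af_tr fP ge'.2).
have qD : 0 <= qform D x.
  rewrite (qform_two_rows _ uv) //; first last.
  - move=> i j iu iv ju jv; rewrite DE !AfE e'E //.
    by rewrite (degO iu iv) (degO ju jv) subrr.
  - by move=> i; rewrite DE !AfE irr ge'.1 subrr.
  rewrite mulr_ge0 // addr_ge0 //.
    by rewrite !mulr_ge0 ?shift_Duv // ltW.
  rewrite (bigID (fun w => e v w && ~~ e u w)) /= addr_ge0 //.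
    rewrite (eq_bigl (fun w => e v w && ~~ e u w && (w != u))) // => w.
    have [->|_] := eqVneq w v; first by rewrite irr andbF.
    by rewrite andbT andbC.
  apply: sumr_ge0 => w /andP[/andP[wu wv] h].
  apply: mulr_ge0; last exact: ltW.
  have h1 := shift_Du_ge wu wv; have h2 := shift_D_common wu wv h.
  have h3 := x0 v.
  (* The rewriting that uses [x v <= x u]: only the sum of the two entries, not [D v w] itself, is
     known to be nonnegative. *)
  have -> : D u w * x u + D v w * x v = D u w * (x u - x v) + (D u w + D v w) * x v.
    by ring.
  by rewrite addr_ge0 // mulr_ge0 // ?subr_ge0 // ltW.
have qE : qform (Af f e') x = qform (Af f e) x + qform D x.
  rewrite /qform -big_split /=; apply: eq_bigr => i _; rewrite -big_split /=.
  by apply: eq_bigr => j _; rewrite DE; ring.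
have [w0 w0Y] := card_gt0P Y0.
have sx : 0 < sqnorm x by apply: (@sqnorm_gt0 _ _ x u); rewrite gt_eqF.
rewrite ltNge; apply/negP => rr.
have q1 := mx' x; rewrite qE (qform_eigen ex) in q1.
have rE : r' = r.
  by apply/le_anti; rewrite rr /= -(ler_pM2r sx); apply: le_trans q1; rewrite lerDl.
have q2 : qform (Af f e') x = r' * sqnorm x.
  by apply/le_anti; rewrite mx' /= rE qE (qform_eigen ex) lerDl.
(* Strictness: [x] is now an eigenvector of both matrices for the same value, so row [u] of [D]
   annihilates it. That row is nonnegative, with a positive entry at any [w0] in [Y]. *)
have ex' := maximizer_eigen (Af_tr fP ge'.2) mx' q2.
have := ex' u; rewrite rE -ex => /eqP; rewrite -subr_eq0 -sumrB.
have [evw euw wu] := hY w0Y.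
have Dge j : 0 <= D u j.
  have [->|ju] := eqVneq j u; first by rewrite DE !AfE irr ge'.1 subrr.
  have [->|jv] := eqVneq j v; first exact: shift_Duv.
  exact: shift_Du_ge.
rewrite (eq_bigr (fun j => D u j * x j)); last by move=> j _; rewrite DE; ring.
apply/negP; rewrite gt_eqF // (bigD1 w0) //= ltr_wpDr //.
  by apply: sumr_ge0 => j _; rewrite mulr_ge0 // ltW.
rewrite mulr_gt0 // shift_Du_Y // fnat_gt0 //; first by rewrite addn_gt0 Y0 orbT.
by rewrite sym in evw; exact: deg_gt0 evw.
Qed.

End ShiftSpectrum.

(** * Graphs of maximal spectral radius *)

Lemma sum_uniq_le (I : finType) (P : pred I) (F : I -> nat) (s : seq I) :
  uniq s -> all P s -> (\sum_(i <- s) F i <= \sum_(i | P i) F i)%N.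
Proof.
move=> us /allP sP; rewrite big_uniq //= big_mkcond [leqRHS]big_mkcond /=.
by apply: leq_sum => i _; case: ifP => // /sP ->.
Qed.

Lemma size_le_deg n (e : rel 'I_n) u s : uniq s -> all (e u) s -> (size s <= deg e u)%N.
Proof.
move=> us /allP es; rewrite -(card_uniqP us); apply: subset_leq_card.
by apply/fintype.subsetP => y /es; rewrite inE.
Qed.

Lemma deg_le_size n (e : rel 'I_n) u s : (forall y, e u y -> y \in s) -> (deg e u <= size s)%N.
Proof.
move=> es; apply: leq_trans (card_size s); apply: subset_leq_card.
by apply/fintype.subsetP => y; rewrite inE => /es.
Qed.

Section Maximal.
Context {R : realType} (f : R -> R -> R).
Hypothesis fP : propP f.
Context {n : nat}.
Hypothesis n6 : (6 <= n)%N.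

(** The edge count is expressed by the degree sum, which shifts visibly preserve. The degree bound
    excludes a vertex adjacent to all others, that is, [B1] and [B2]. *)
Definition admissible (e : rel 'I_n) := [/\ simple_graph e, connected_graph e,
  (\sum_i deg e i = 2 * n.+1)%N & forall i, (deg e i <= n - 2)%N].

Context (e : rel 'I_n) (r : R) (x : 'I_n -> R).
Hypothesis ae : admissible e.
Hypothesis pe : perron_pair f e r x.
Hypothesis me : forall e' r', admissible e' -> largest_eigenvalue (Af f e') r' -> r' <= r.

Let ge : simple_graph e. Proof. by case: ae. Qed.
Let irr := ge.1.
Let sym := ge.2.

(** The vertex [t] certifies admissibility of the shifted graph: [u] misses both itself and [t], so
    its degree stays at most n - 2, and no other degree grows. *)
Lemma maximal_no_shift (u v : 'I_n) (Y : {set 'I_n}) (t : 'I_n) : u != v ->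
  (forall w, w \in Y -> [/\ e v w, ~~ e u w & w != u]) ->
  (0 < #|Y|)%N -> (deg e v <= deg e u + #|Y|)%N ->
  e u v \/ (exists z, e u z && e v z) -> x v <= x u ->
  t != u -> ~~ shift e u v Y u t ->
  0 <= \sum_(w | e v w && ~~ e u w && (w != u))
    ((Af f (shift e u v Y) - Af f e) u w * x u +
     (Af f (shift e u v Y) - Af f e) v w * x v) * x w -> False.
Proof.
move=> uv hY Y0 degY con xvu tu ut hP.
have [_ ce se de] := ae.
have gs := shift_simple ge hY; have cs := shift_connected ge uv hY ce con.
have as' : admissible (shift e u v Y).
  split=> //; first by rewrite sum_deg_shift.
  move=> i; have [->|iu] := eqVneq i u.
    have -> : (n - 2 = #|~: [set u; t]|)%N.
      by rewrite cardsCs finset.setCK card_ord cards2 eq_sym tu.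
    apply: subset_leq_card; apply/fintype.subsetP => j; rewrite !inE negb_or => uj.
    by apply/andP; split; apply/eqP => je; move: uj; rewrite je ?gs.1 // (negPf ut).
  have [->|iv] := eqVneq i v; last by rewrite deg_shift_other.
  by apply: leq_trans (de v); rewrite -(deg_shift_v ge uv hY) leq_addr.
have n0 : (0 < n)%N by apply: leq_trans n6.
have [r' [y py]] := perron_exists fP n0 gs cs.
have rr := @shift_rho_lt _ _ fP _ _ _ _ _ ge uv hY Y0 degY r x r' pe xvu hP.
have [_ _ my] := py.
have := me as' (perron_largest fP n0 gs.2 py).
by rewrite leNgt rr.
Qed.


(* The Kelmans transformation: all private neighbours of [v] move to [u]. *)
Lemma maximal_kelmans_le (u v b : 'I_n) : u != v ->
  e u v \/ (exists z, e u z && e v z) -> x v <= x u ->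
  [/\ e v b, ~~ e u b & b != u] ->
  ~~ e u v \/ (exists t, [/\ t != u, t != v, ~~ e u t & ~~ e v t]) -> False.
Proof.
move=> uv con xvu [evb eub bu] ht.
have x0 : forall i, 0 < x i by case: pe.
pose Y := [set w | e v w && ~~ e u w && (w != u)].
have hY w : w \in Y -> [/\ e v w, ~~ e u w & w != u].
  by rewrite inE => /andP[/andP[]].
have Y0 : (0 < #|Y|)%N by apply/card_gt0P; exists b; rewrite inE evb eub.
(* What [v] keeps are common neighbours and possibly [u]. The former are neighbours of [u], and the
   latter is matched by the neighbour [v] of [u]. This is the condition [degY] of the shift
   estimates. *)
have dv' : (deg (shift e u v Y) v <= deg e u)%N.
  have [euv|euv] := boolP (e u v); last first.
    apply: subset_leq_card; apply/fintype.subsetP => j.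
    rewrite !inE shift_vE // inE => /andP[+ evj]; rewrite evj /= negb_and !negbK.
    by case/orP => // /eqP ju; rewrite sym -ju evj in euv.
  rewrite /deg (cardsD1 u) [leqRHS](cardsD1 v) !inE euv.
  apply: leq_add; first exact: leq_b1.
  apply: subset_leq_card; apply/fintype.subsetP => j.
  rewrite !inE shift_vE // inE => /and3P[ju + evj]; rewrite evj ju /= andbT negbK => ->.
  by rewrite andbT; apply/eqP => jv; rewrite jv irr in evj.
have dY : (deg e v <= deg e u + #|Y|)%N.
  by rewrite -(deg_shift_v ge uv hY) leq_add2r.
have [t tu tt] : exists2 t, t != u & ~~ shift e u v Y u t.
  case: ht => [euv|[t [tu tv eut evt]]].
    by exists v; rewrite 1?eq_sym // shift_uE // inE irr.
  by exists t => //; rewrite shift_uE // inE (negPf evt) (negPf eut).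
apply: (maximal_no_shift uv hY Y0 dY con xvu tu tt).
apply: sumr_ge0 => w hw; have wY : w \in Y by rewrite inE.
have [evw euw wu] := hY w wY.
rewrite (shift_Du_Y _ ge) // (shift_Dv_Y _ ge) //.
rewrite mulr_ge0 //; last exact: ltW.
have dw : (0 < deg e w)%N by rewrite (@deg_gt0 _ _ _ v) // sym.
have f1 : 0 < fnat f (deg e v) (deg e w) by rewrite fnat_gt0 // (deg_gt0 evw).
have f2 : fnat f (deg e v) (deg e w) <= fnat f (deg e u + #|Y|) (deg e w).
  by apply: fnat_le => //; exact: deg_gt0 evw.
rewrite mulNr subr_ge0; apply: ler_pM => //; exact: ltW.
Qed.

(** With private neighbours on both sides, the move can go towards whichever vertex has the larger
    Perron entry. Either direction produces the same obstruction, a vertex adjacent to all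
    others. *)
Lemma maximal_kelmans (u v a b : 'I_n) : u != v ->
  e u v \/ (exists z, e u z && e v z) ->
  [/\ e u a, ~~ e v a & a != v] -> [/\ e v b, ~~ e u b & b != u] ->
  e u v /\ forall y, y != u -> y != v -> e u y || e v y.
Proof.
move=> uv con ha hb; apply: contrapT => H.
have ht : ~~ e u v \/ (exists t, [/\ t != u, t != v, ~~ e u t & ~~ e v t]).
  have [euv|] := boolP (e u v); last by left.
  right; apply: contrapT => H2; apply: H; split=> // y yu yv.
  apply: contraT; rewrite negb_or => /andP[h1 h2].
  by case: H2; exists y.
have [xvu|/ltW xuv] := leP (x v) (x u).
  exact: (maximal_kelmans_le uv con xvu hb).
apply: (maximal_kelmans_le _ _ xuv ha); first by rewrite eq_sym.
  case: con => [euv|[z /andP[h1 h2]]]; first by left; rewrite sym.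
  by right; exists z; rewrite h2.
case: ht => [euv|[t [h1 h2 h3 h4]]]; first by left; rewrite sym.
by right; exists t; split.
Qed.
End Maximal.

(** * Structure of Kelmans-stable bicyclic graphs *)

Lemma exists_notin n (s : seq 'I_n) : (size s < n)%N -> exists y, y \notin s.
Proof.
move=> sn; apply: contrapT => H.
have : (n <= size s)%N; last by rewrite leqNgt sn.
rewrite -{1}(card_ord n); apply: leq_trans (card_size s).
apply: subset_leq_card; apply/fintype.subsetP => y _.
by apply: contraT => ys; case: H; exists y.
Qed.

Lemma perm_of_uniq n (d : 'I_n) (l : seq 'I_n) : uniq l -> exists s : {perm 'I_n},
  (forall i : 'I_n, (i < size l)%N -> s i = nth d l i) /\
  (forall i : 'I_n, (size l <= i)%N -> s i \notin l).
Proof.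
move=> ul; pose m := l ++ [seq x <- enum 'I_n | x \notin l].
have um : uniq m.
  rewrite cat_uniq ul filter_uniq ?enum_uniq // andbT /=.
  by apply/hasPn => x; rewrite mem_filter => /andP[].
have sm : size m = n.
  rewrite -[RHS]card_ord cardE; apply: perm_size; apply: uniq_perm => //.
    exact: enum_uniq.
  by move=> x; rewrite mem_cat mem_filter mem_enum andbT orbN.
have inj : injective (fun i : 'I_n => nth d m i).
  by move=> i j /eqP; rewrite nth_uniq ?sm // => /eqP /val_inj.
exists (perm inj); split=> i il; rewrite permE nth_cat.
  by rewrite il.
rewrite ltnNge il /=.
have : nth d [seq x <- enum 'I_n | x \notin l] (i - size l) \in
    [seq x <- enum 'I_n | x \notin l].
  by rewrite mem_nth // -(ltn_add2l (size l)) subnKC // -size_cat sm.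
by rewrite mem_filter => /andP[].
Qed.

(** Position in [l] is the label of a special vertex, and all vertices outside [l] share one
    adjacency pattern, so the order in which they receive the remaining labels is irrelevant. *)
Lemma iso_of_pairs n (e B : rel 'I_n) (d : 'I_n) (l : seq 'I_n) (bn : nat -> nat -> bool) :
  simple_graph e -> uniq l ->
  (forall i j : 'I_n, B i j = bn i j || bn j i) -> (forall k, bn k k = false) ->
  (forall k m, (k < m < size l)%N -> e (nth d l k) (nth d l m) = bn k m || bn m k) ->
  (forall k t x, (k < size l)%N -> (size l <= t)%N -> x \notin l ->
     e (nth d l k) x = bn k t || bn t k) ->
  (forall t t' x y, (size l <= t)%N -> (size l <= t')%N -> x \notin l -> y \notin l ->
     e x y = bn t t' || bn t' t) ->
  isomorphic e B.
Proof.
move=> [irr sym] ul BE bn0 h1 h2 h3.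
have [s [sl sN]] := perm_of_uniq d ul.
exists s => i j; rewrite BE.
have [il|il] := ltnP i (size l); have [jl|jl] := ltnP j (size l).
- rewrite !sl //; case: (ltngtP i j) => ij.
  + by rewrite h1 // ij.
  + by rewrite sym h1 ?ij // orbC.
  + by rewrite ij irr bn0.
- by rewrite (sl i) // (h2 _ j) // sN.
- by rewrite (sl j) // sym (h2 _ i) 1?orbC // sN.
- by apply: h3; rewrite ?sN.
Qed.

(** The combinatorial residue of maximality: neither [f] nor the Perron vector occurs, and the
    classification below uses nothing else about the maximiser beyond its edge count. *)
Definition kelmans_stable n (e : rel 'I_n) := forall u v a b, u != v ->
  e u v \/ (exists z, e u z && e v z) ->
  [/\ e u a, ~~ e v a & a != v] -> [/\ e v b, ~~ e u b & b != u] ->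
  e u v /\ forall y, y != u -> y != v -> e u y || e v y.

(* For an edge [cv] with every vertex adjacent to [c] or [v], these weights add
   up to 4: twice the number of common neighbours of [c] and [v] plus twice the
   number of edges avoiding both. *)
Definition excess n (e : rel 'I_n) c v y :=
  (#|[set t | e y t && (t != c) && (t != v)]| + 2 * (e c y && e v y))%N.

Section Pair.
Context {n : nat} (e : rel 'I_n) (c v z0 w0 : 'I_n).
Hypothesis n6 : (6 <= n)%N.
Hypothesis ge : simple_graph e.
Hypothesis tot : (\sum_i deg e i = 2 * n.+1)%N.
Hypothesis kel : kelmans_stable e.
Hypothesis ecv : e c v.
Hypothesis hz0 : [/\ e c z0, ~~ e v z0 & z0 != v].
Hypothesis hw0 : [/\ e v w0, ~~ e c w0 & w0 != c].

Let irr := ge.1.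
Let sym := ge.2.

Let neq a b : e a b -> a != b.
Proof. by move=> eab; apply/eqP => ab; rewrite ab irr in eab. Qed.
Let neq3 a b d : e a b -> ~~ e a d -> b != d.
Proof. by move=> eab ead; apply/eqP => ab; rewrite -ab eab in ead. Qed.

Let cv : c != v. Proof. exact: neq. Qed.
Let vc : v != c. Proof. by rewrite eq_sym. Qed.
Let evc : e v c. Proof. by rewrite sym. Qed.

Lemma pair_dom y : y != c -> y != v -> e c y || e v y.
Proof. by have [_] := kel cv (or_introl ecv) hz0 hw0; exact. Qed.

Local Notation om := (excess e c v).

(** The edges at [c] and [v] contain a spanning double star with n - 1 edges. Each of the two
    surplus edges contributes 2: as a second edge to a common neighbour, or through its two
    endpoints. *)
Lemma sum_excess : (\sum_(y | (y != c) && (y != v)) om y = 4)%N.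
Proof.
pose P : pred 'I_n := fun y => (y != c) && (y != v).
have degS y : deg e y = (\sum_t e y t)%N.
  by rewrite /deg -sum1_card big_mkcond; apply: eq_bigr => t _; rewrite inE; case: (e y t).
have split2 (F : 'I_n -> nat) : (\sum_y F y = F c + (F v + \sum_(y | P y) F y))%N.
  by rewrite (bigD1 c) //= (bigD1 v).
have dc : (deg e c = 1 + \sum_(y | P y) e c y)%N by rewrite degS split2 irr ecv add0n.
have dv : (deg e v = 1 + \sum_(y | P y) e v y)%N by rewrite degS split2 irr evc add0n.
have dy y : deg e y = (#|[set t | e y t && (t != c) && (t != v)]| + (e c y + e v y))%N.
  rewrite degS split2 (sym y c) (sym y v) addnA addnC; congr addn.
  rewrite -sum1_card big_mkcond [RHS]big_mkcond /=; apply: eq_bigr => t _.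
  by rewrite inE -andbA /P; case: (_ && _); rewrite ?andbT ?andbF //; case: (e y t).
have cP : (\sum_(y | P y) 1 = n - 2)%N.
  have := split2 (fun=> 1%N); rewrite sum1_card card_ord; lia.
have K1 : (\sum_(y | P y) (e c y + e v y) =
    \sum_(y | P y) (1 + (e c y && e v y)))%N.
  apply: eq_bigr => y /andP[yc yv]; have := pair_dom yc yv.
  by case: (e c y); case: (e v y).
have -> : (\sum_(y | (y != c) && (y != v)) om y =
    \sum_(y | P y) #|[set t | e y t && (t != c) && (t != v)]| +
    2 * \sum_(y | P y) (e c y && e v y))%N.
  by rewrite /excess big_split /= big_distrr.
have := tot; rewrite split2 dc dv.
rewrite (eq_bigr _ (fun y _ => dy y)) !big_split /=.
move: K1; rewrite !big_split /= cP; lia.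
Qed.

Lemma excess_le s : uniq s -> all (fun y => (y != c) && (y != v)) s ->
  (\sum_(y <- s) om y <= 4)%N.
Proof. by move=> us sP; rewrite -sum_excess; exact: sum_uniq_le. Qed.

Lemma excess_ge y s : uniq s -> all (fun t => e y t && (t != c) && (t != v)) s ->
  (size s + 2 * (e c y && e v y) <= om y)%N.
Proof.
move=> us /allP es; rewrite leq_add2r -(card_uniqP us); apply: subset_leq_card.
by apply/fintype.subsetP => t /es; rewrite inE.
Qed.

(** Such an edge closes a 4-cycle [c], [v], [w], [z], and stability at [c z] and [v w] gives two
    more dominating pairs. Then [z], [w] and two further vertices, available as n is at least 6,
    each have excess at least 1, which already uses up 4. But the adjacencies of [y1] force a second
    unit at [z], at [w] or at [y1] itself. *)
Lemma pair_noZW z w : [/\ e c z, ~~ e v z & z != v] ->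
  [/\ e v w, ~~ e c w & w != c] -> ~~ e z w.
Proof.
move=> [ecz evz zv] [evw ecw wc]; apply/negP => ezw.
have cz := neq ecz; have vw := neq evw; have zw := neq ezw.
have zc : z != c by rewrite eq_sym.
have wv : w != v by rewrite eq_sym.
have ewz : e w z by rewrite sym.
have [_ domcz] : e c z /\ forall y, y != c -> y != z -> e c y || e z y.
  by apply: (@kel c z v w) => //; [left | split=> //; rewrite 1?sym // eq_sym].
have [_ domvw] : e v w /\ forall y, y != v -> y != w -> e v y || e w y.
  by apply: (@kel v w c z) => //; [left | split=> //; rewrite 1?sym // eq_sym].
have [y1 y1N] : exists y, y \notin [:: c; v; z; w] by apply: exists_notin; exact: leq_trans n6.
have [y2 y2N] : exists y, y \notin [:: c; v; z; w; y1] by apply: exists_notin; exact: leq_trans n6.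
move: y1N y2N; rewrite !inE !negb_or => /and4P[y1c y1v y1z y1w] /and5P[y2c y2v y2z y2w y21].
have Hz y : y != c -> y != z -> ~~ e c y -> e z y.
  by move=> yc yz ecy; have := domcz y yc yz; rewrite (negPf ecy).
have Hw y : y != v -> y != w -> ~~ e v y -> e w y.
  by move=> yv yw evy; have := domvw y yv yw; rewrite (negPf evy).
have H := @excess_le [:: z; w; y1; y2]; rewrite !big_cons big_nil /= in H.
rewrite !inE !negb_or zc zv wc wv y1c y1v y2c y2v zw !(eq_sym z) y1z y2z in H.
rewrite !(eq_sym w) y1w y2w (eq_sym y1) y21 /= in H.
have {}H := H isT isT.
have omz : (0 < om z)%N by have := @excess_ge z [:: w]; rewrite /= ezw wc wv /= => /(_ isT isT); clear; lia.
have omw : (0 < om w)%N by have := @excess_ge w [:: z]; rewrite /= ewz zc zv /= => /(_ isT isT); clear; lia.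
have omy y : y != c -> y != v -> y != z -> y != w -> (0 < om y)%N.
  move=> yc yv yz yw.
  have [ecy|ecy] := boolP (e c y); last first.
    have := @excess_ge y [:: z]; rewrite /= sym (Hz _ yc yz ecy) zc zv => /(_ isT isT); clear; lia.
  have [evy|evy] := boolP (e v y); last first.
    have := @excess_ge y [:: w]; rewrite /= sym (Hw _ yv yw evy) wc wv => /(_ isT isT); clear; lia.
  by have := @excess_ge y [::] isT isT; rewrite ecy evy; clear; lia.
have o1 := omy _ y1c y1v y1z y1w; have o2 := omy _ y2c y2v y2z y2w.
have [ecy|ecy] := boolP (e c y1); last first.
  have := @excess_ge z [:: w; y1]; rewrite /= !inE eq_sym y1w ezw (Hz _ y1c y1z ecy) wc wv y1c y1v.
  by move=> /(_ isT isT) /=; move: H omz omw o1 o2; clear; lia.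
have [evy|evy] := boolP (e v y1); last first.
  have := @excess_ge w [:: z; y1]; rewrite /= !inE eq_sym y1z ewz (Hw _ y1v y1w evy) zc zv y1c y1v.
  by move=> /(_ isT isT) /=; move: H omz omw o1 o2; clear; lia.
by have := @excess_ge y1 [::] isT isT; rewrite ecy evy /=; move: H omz omw o1 o2; clear; lia.
Qed.

(** Stability applies to the nonadjacent pair [z], [v] with common neighbour [c]: [z'] is private to
    [z], and [w0] to [v]. It would force an edge [z v]. *)
Lemma pair_noZZ z z' : [/\ e c z, ~~ e v z & z != v] ->
  [/\ e c z', ~~ e v z' & z' != v] -> ~~ e z z'.
Proof.
move=> hz hz'; apply/negP => ezz.
have [ecz evz zv] := hz; have [ecz' evz' zv'] := hz'; have [evw ecw wc] := hw0.
have [] : e z v /\ forall y, y != z -> y != v -> e z y || e v y.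
  apply: (@kel z v z' w0) => //.
  - by right; exists c; rewrite sym ecz evc.
  - split=> //; first exact: pair_noZW.
    by rewrite (neq3 evw).
by rewrite sym (negPf evz).
Qed.

(** Here [a] has excess at least 3 and [z] at least 1, so every other vertex has excess 0. Stability
    at the edge [v a] then attaches all remaining vertices to [v] alone. *)
Lemma pair_AZ_B4 a z : e c a -> e v a -> [/\ e c z, ~~ e v z & z != v] ->
  e a z -> isomorphic e (B4 n).
Proof.
move=> eca eva hz eaz; have [ecz evz zv] := hz; have [evw ecw wc] := hw0.
have ac : a != c by rewrite eq_sym neq.
have av : a != v by rewrite eq_sym neq.
have zc : z != c by rewrite eq_sym neq.
have wv : w0 != v by rewrite eq_sym neq.
have az := neq eaz; have za : z != a by rewrite eq_sym.
have eza : e z a by rewrite sym.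
have eav : e a v by rewrite sym.
have hA s : uniq (z :: s) -> all (fun t => e a t && (t != c) && (t != v)) s ->
    (size s + 3 <= om a)%N.
  move=> us es; have := @excess_ge a _ us; rewrite /= eaz zc zv eca eva es => /(_ isT).
  by rewrite /=; clear; lia.
have hZ s : uniq (a :: s) -> all (fun t => e z t && (t != c) && (t != v)) s ->
    (size s + 1 <= om z)%N.
  by move=> us es; have := @excess_ge z _ us; rewrite /= eza ac av es => /(_ isT); clear; lia.
have hAZ s : uniq (a :: z :: s) -> all (fun y => (y != c) && (y != v)) s ->
    (om a + om z + \sum_(y <- s) om y <= 4)%N.
  by move=> us sP; have := excess_le us; rewrite /= ac av zc zv sP !big_cons addnA; exact.
have omaz : (om a + om z <= 4)%N.
  by have := hAZ [::]; rewrite /= inE az big_nil addn0; exact.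
have oma := hA [::] isT isT; have omz := hZ [::] isT isT.
have eaw : ~~ e a w0.
  apply/negP => eaw; have := hA [:: w0]; rewrite /= inE eaw wc wv.
  by rewrite (neq3 ecz) // => /(_ isT isT) /=; move: oma omz omaz; clear; lia.
have [_ domva] : e v a /\ forall y, y != v -> y != a -> e v y || e a y.
  apply: (@kel v a w0 z); [by rewrite eq_sym | by left | | by []].
  by split=> //; rewrite eq_sym (neq3 eca).
have hO y : y \notin [:: c; a; v; z] -> [/\ ~~ e c y, e v y, ~~ e a y, ~~ e z y &
    forall t, t \notin [:: c; a; v; z] -> ~~ e y t].
  rewrite !inE !negb_or => /and4P[yc ya yv yz].
  have eay : ~~ e a y.
    apply/negP => eay; have := hA [:: y]; rewrite /= inE eq_sym yz eay yc yv.
    by move=> /(_ isT isT) /=; move: oma omz omaz; clear; lia.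
  have evy : e v y by have := domva y yv ya; rewrite (negPf eay) orbF.
  have omy : om y = 0%N.
    have := hAZ [:: y]; rewrite /= !inE !negb_or az !(eq_sym _ y) ya yz yc yv.
    by move=> /(_ isT isT); rewrite big_cons big_nil /=; move: oma omz; clear; lia.
  have ecy : ~~ e c y.
    by apply/negP => ecy; have := @excess_ge y [::] isT isT; rewrite ecy evy omy.
  split=> //.
    apply/negP => ezy; have := hZ [:: y]; rewrite /= inE eq_sym ya ezy yc yv.
    by move=> /(_ isT isT) /=; move: oma omz omaz; clear; lia.
  move=> t; rewrite !inE !negb_or => /and4P[tc ta tv tz]; apply/negP => eyt.
  by have := @excess_ge y [:: t]; rewrite /= eyt tc tv omy => /(_ isT isT).
(* The adjacent degree-3 vertices of the diamond are [c] and [a]; [v] takes label 2, the degree-2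
   vertex carrying the pendants. *)
apply: (@iso_of_pairs _ _ _ c [:: c; a; v; z]
  (fun i j => diamond_adj i j || (i == 2)%N && (4 <= j)%N)) => //.
- by rewrite /= !inE !negb_or az cv av (eq_sym c) ac (eq_sym c) zc eq_sym zv.
- by case=> [|[|[|[|[|k]]]]].
- by move=> [|[|[|[|k]]]] [|[|[|[|m]]]] /andP[] //= _ _;
    rewrite ?eca ?ecv ?ecz ?eaz ?eav ?(negPf evz).
- move=> [|[|[|[|k]]]] [|[|[|[|t]]]] // y _ _ yl; have [h1 h2 h3 h4 _] := hO y yl => /=.
  + exact: negPf.
  + exact: negPf.
  + by [].
  + exact: negPf.
- move=> [|[|[|[|k]]]] [|[|[|[|t]]]] // x y _ _ xl yl.
  by have [_ _ _ _ /(_ y yl)/negPf] := hO x xl.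
Qed.

End Pair.

Section PairStructure.
Context {n : nat} (e : rel 'I_n) (c v z0 w0 : 'I_n).
Hypothesis n6 : (6 <= n)%N.
Hypothesis ge : simple_graph e.
Hypothesis tot : (\sum_i deg e i = 2 * n.+1)%N.
Hypothesis kel : kelmans_stable e.
Hypothesis ecv : e c v.
Hypothesis hz0 : [/\ e c z0, ~~ e v z0 & z0 != v].
Hypothesis hw0 : [/\ e v w0, ~~ e c w0 & w0 != c].

Let irr := ge.1.
Let sym := ge.2.
Let evc : e v c. Proof. by rewrite sym. Qed.
Let cv : c != v. Proof. by apply/eqP => cv; move: ecv; rewrite cv irr. Qed.

(* The diamond on [c, v, a, b] with all remaining vertices pendant at [c] or [v]. *)
Definition double_broom a b := [/\ a != b, e c a && e v a, e c b && e v b,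
  forall y, e c y -> e v y -> y = a \/ y = b &
  forall x y, x != c -> x != v -> y != c -> y != v -> ~~ e x y].

(** Every vertex other than [c] and [v] is a common neighbour or private to one of them. Edges among
    private vertices are excluded, and an edge between a common and a private one gives [B4]. *)
Lemma pair_structure : isomorphic e (B4 n) \/ exists a b, double_broom a b.
Proof.
have [[a [z [eca eva hz eaz]]]|AZ] := pselect (exists a z,
  [/\ e c a, e v a, [/\ e c z, ~~ e v z & z != v] & e a z]).
  by left; exact: (pair_AZ_B4 n6 ge tot kel ecv hz0 hw0 eca eva hz eaz).
have [[a [w [eca eva hw eaw]]]|AW] := pselect (exists a w,
  [/\ e c a, e v a, [/\ e v w, ~~ e c w & w != c] & e a w]).
  by left; exact: (pair_AZ_B4 n6 ge tot kel evc hw0 hz0 eva eca hw eaw).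
right.
have inner x y : x != c -> x != v -> y != c -> y != v -> ~~ e x y.
  move=> xc xv yc yv; apply/negP => exy.
  have eyx : e y x by rewrite sym.
  have xy : x != y by apply/eqP => xy; rewrite xy irr in exy.
  have dx := pair_dom ge kel ecv hz0 hw0 xc xv.
  have dy := pair_dom ge kel ecv hz0 hw0 yc yv.
  have [ecx|ecx] := boolP (e c x); have [evx|evx] := boolP (e v x); last first.
  - by rewrite (negPf ecx) (negPf evx) in dx.
  - have [ecy|ecy] := boolP (e c y); have [evy|evy] := boolP (e v y); last first.
    + by rewrite (negPf ecy) (negPf evy) in dy.
    + by have := pair_noZZ n6 ge tot kel evc hw0 hz0 (And3 evx ecx xc) (And3 evy ecy yc); rewrite exy.
    + by have := pair_noZW n6 ge tot kel ecv hz0 hw0 (And3 ecy evy yv) (And3 evx ecx xc); rewrite eyx.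
    + by apply: AW; exists y, x.
  - have [ecy|ecy] := boolP (e c y); have [evy|evy] := boolP (e v y); last first.
    + by rewrite (negPf ecy) (negPf evy) in dy.
    + by have := pair_noZW n6 ge tot kel ecv hz0 hw0 (And3 ecx evx xv) (And3 evy ecy yc); rewrite exy.
    + by have := pair_noZZ n6 ge tot kel ecv hz0 hw0 (And3 ecx evx xv) (And3 ecy evy yv); rewrite exy.
    + by apply: AZ; exists y, x.
  - have [ecy|ecy] := boolP (e c y); have [evy|evy] := boolP (e v y); last first.
    + by rewrite (negPf ecy) (negPf evy) in dy.
    + by apply: AW; exists x, y.
    + by apply: AZ; exists x, y.
    (* Two adjacent common neighbours would have excess at least 3 each. *)
    + have := @excess_le _ _ _ _ _ _ n6 ge tot kel ecv hz0 hw0 [:: x; y].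
      rewrite /= inE xy xc xv yc yv !big_cons big_nil => /(_ isT isT).
      have := @excess_ge _ e c v x [:: y]; rewrite /= exy yc yv ecx evx => /(_ isT isT).
      have := @excess_ge _ e c v y [:: x]; rewrite /= eyx xc xv ecy evy => /(_ isT isT).
      by clear; lia.
(* Without edges avoiding [c] and [v], the total excess 4 is twice the number of common
   neighbours. *)
pose S := [set y | e c y && e v y].
have S2 : (#|S| == 2)%N.
  rewrite -(eqn_pmul2l (isT : 0 < 2)%N).
  rewrite -[(2 * 2)%N](sum_excess n6 ge tot kel ecv hz0 hw0) -sum1_card big_distrr /=.
  rewrite big_mkcond [X in _ == X]big_mkcond; apply/eqP/eq_bigr => y _.
  rewrite inE /excess.
  have [->|yc] := eqVneq y c; first by rewrite irr.
  have [->|yv] := eqVneq y v; first by rewrite irr andbF.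
  rewrite (_ : [set _ | _] = finset.set0) ?cards0; first by case: (_ && _).
  apply/setP => t; rewrite !inE; apply/negP => /andP[/andP[eyt tc] tv].
  by have := inner y t yc yv tc tv; rewrite eyt.
have [a [b [ab SE]]] : exists a b, a != b /\ S = [set a; b].
  by move/cards2P: S2 => [a [b [ab SE]]]; exists a, b.
have SP y : (e c y && e v y) = (y == a) || (y == b).
  by have := in_set2 y a b; rewrite -SE inE.
exists a, b; split=> //; rewrite ?SP ?eqxx ?orbT // => y ecy evy.
by have := SP y; rewrite ecy evy => /esym/orP[/eqP|/eqP]; [left | right].
Qed.

Lemma double_broom_B3 a b : double_broom a b ->
  (forall y, e v y -> ~~ e c y -> y != c -> y = w0) -> isomorphic e (B3 n).
Proof.
move=> [ab /andP[eca eva] /andP[ecb evb] K inner] W.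
have [evw ecw wc] := hw0.
have neq x y : e x y -> y != x.
  by move=> exy; apply/eqP => xy; rewrite xy irr in exy.
have [[ac bc] vc] := (neq _ _ eca, neq _ _ ecb, neq _ _ ecv).
have [[av bv] wv] := (neq _ _ eva, neq _ _ evb, neq _ _ evw).
have aw : a != w0 by apply/eqP => aw; rewrite -aw eca in ecw.
have bw : b != w0 by apply/eqP => bw; rewrite -bw ecb in ecw.
have hO y : y \notin [:: c; v; a; b; w0] -> [/\ e c y, ~~ e v y, y != c & y != v].
  rewrite !inE !negb_or => /and5P[yc yv ya yb yw].
  have d := pair_dom ge kel ecv hz0 hw0 yc yv.
  suff evy : ~~ e v y by rewrite (negPf evy) orbF in d.
  apply/negP => evy; have [ecy|ecy] := boolP (e c y).
    by have [yE|yE] := K y ecy evy; move: ya yb; rewrite yE eqxx.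
  by move: yw; rewrite (W y) // eqxx.
apply: (@iso_of_pairs _ _ _ c [:: c; v; a; b; w0]
  (fun i j => [|| diamond_adj i j, (i == 1) && (j == 4) | (i == 0) && (5 <= j)]%N)) => //.
- by rewrite /= !inE !negb_or !(eq_sym c) vc ac bc wc !(eq_sym v) av bv wv ab aw bw.
- by case=> [|[|[|[|[|[|k]]]]]].
- by move=> [|[|[|[|[|k]]]]] [|[|[|[|[|m]]]]] /andP[] //= _ _;
    rewrite ?eca ?ecv ?ecb ?eva ?evb ?evw ?(negPf ecw) ?(negPf (inner _ _ _ _ _ _)).
- move=> [|[|[|[|[|k]]]]] [|[|[|[|[|t]]]]] // y _ _ yl;
    have [h1 h2 h3 h4] := hO y yl => /=.
  + by [].
  + exact: negPf.
  + exact: (negPf (inner a y ac av h3 h4)).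
  + exact: (negPf (inner b y bc bv h3 h4)).
  + exact: (negPf (inner w0 y wc wv h3 h4)).
- move=> [|[|[|[|[|k]]]]] [|[|[|[|[|t]]]]] // x y _ _ xl yl.
  have [_ _ h3 h4] := hO x xl; have [_ _ h5 h6] := hO y yl.
  exact: (negPf (inner x y h3 h4 h5 h6)).
Qed.

End PairStructure.

(** * Shape of a maximiser *)

Section MaximalStructure.
Context {R : realType} (f : R -> R -> R).
Hypothesis fP : propP f.
Context {n : nat}.
Hypothesis n6 : (6 <= n)%N.
Context (e : rel 'I_n) (r : R) (x : 'I_n -> R).
Hypothesis ae : admissible e.
Hypothesis pe : perron_pair f e r x.
Hypothesis me : forall (e' : rel 'I_n) r', admissible e' -> largest_eigenvalue (Af f e') r' -> r' <= r.

Let ge : simple_graph e. Proof. by case: ae. Qed.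
Let irr := ge.1.
Let sym := ge.2.
Let neq i j : e i j -> j != i.
Proof. by move=> eij; apply/eqP => ij; rewrite ij irr in eij. Qed.

(* Moving all pendant vertices of [v] but one to [u] increases the spectral
   radius by convexity of [f], since pendant vertices at [v] have equal Perron
   entries. *)
Lemma double_broom_not_maximal u v a b z1 z2 w1 w2 : e u v ->
  double_broom e u v a b -> x v <= x u ->
  z1 != z2 -> (forall z, z \in [:: z1; z2] -> [/\ e u z, ~~ e v z & z != v]) ->
  w1 != w2 -> (forall w, w \in [:: w1; w2] -> [/\ e v w, ~~ e u w & w != u]) -> False.
Proof.
move=> euv [ab /andP[eua eva] /andP[eub evb] K inner] xvu z12 hz w12 hw.
have [x0 ex _] := pe.
have evu : e v u by rewrite sym.
have uv : u != v by exact: neq.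
have [euz1 evz1 z1v] := hz z1 (mem_head _ _).
have [euz2 evz2 z2v] := hz z2 ltac:(by rewrite !inE eqxx orbT).
have [evw1 euw1 w1u] := hw w1 (mem_head _ _).
have [evw2 euw2 w2u] := hw w2 ltac:(by rewrite !inE eqxx orbT).
(* The pendant vertex [w1] stays at [v], so that [u] does not become adjacent to all other
   vertices. *)
pose Y := [set w | [&& e v w, ~~ e u w, w != u & w != w1]].
have hY w : w \in Y -> [/\ e v w, ~~ e u w & w != u] by rewrite inE => /and4P[].
have Y0 : (0 < #|Y|)%N.
  by apply/card_gt0P; exists w2; rewrite inE evw2 euw2 w2u eq_sym.
have neqs p q d : e p q -> ~~ e p d -> q != d.
  by move=> h1 h2; apply/eqP => qd; rewrite qd (negPf h2) in h1.
have dv4 : deg (shift e u v Y) v = 4%N.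
  apply/eqP; rewrite eqn_leq; apply/andP; split.
    apply: (@deg_le_size _ _ _ [:: u; a; b; w1]) => t.
    rewrite shift_vE // !inE !negb_and !negbK => /andP[+ evt]; rewrite evt /=.
    case/or3P => [eut|->|->]; rewrite ?orbT //.
    by have [->|->] := K t eut evt; rewrite eqxx ?orbT.
  apply: (@size_le_deg _ _ _ [:: u; a; b; w1]).
    rewrite /= !inE !negb_or ab !(eq_sym u) (neq eua) (neq eub) w1u.
    by rewrite (neqs _ _ _ eua euw1) (neqs _ _ _ eub euw1).
  rewrite /= !shift_vE // !inE irr evu eua eva eub evb evw1 !eqxx /=.
  by rewrite ?andbF.
have dv : deg e v = (4 + #|Y|)%N by rewrite -(deg_shift_v ge uv hY) dv4.
(* Two private neighbours at [u] give degree at least 5, one more than the 4 neighbours left at [v];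
   this extra unit makes [g' <= F] below. *)
have du : (5 <= deg e u)%N.
  apply: (@size_le_deg _ _ _ [:: v; a; b; z1; z2]); last first.
    by rewrite /= euv eua eub euz1 euz2.
  rewrite /= !inE !negb_or ab z12 !(eq_sym v) (neq eva) (neq evb) z1v z2v.
  by rewrite (neqs _ _ _ eva evz1) (neqs _ _ _ eva evz2) (neqs _ _ _ evb evz1) (neqs _ _ _ evb evz2).
have degY : (deg e v <= deg e u + #|Y|)%N by rewrite dv leq_add2r ltnW.
have pend w t : e v w -> ~~ e u w -> w != u -> e w t -> t = v.
  move=> evw euw wu ewt; apply/eqP; apply: contraT => tv.
  have [tu|tu] := eqVneq t u; first by rewrite tu sym (negPf euw) in ewt.
  by have := inner w t wu (neq evw) tu tv; rewrite ewt.
have pdeg w : e v w -> ~~ e u w -> w != u -> deg e w = 1%N.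
  move=> evw euw wu; apply/eqP; rewrite eqn_leq; apply/andP; split.
    by apply: (@deg_le_size _ _ _ [:: v]) => t /(pend w t evw euw wu) ->; rewrite inE.
  by rewrite (@deg_gt0 _ _ _ v) // sym.
have A0 i j : 0 <= Af f e i j by exact: Af_ge0.
have r0 : 0 < r.
  rewrite -(pmulr_lgt0 _ (x0 u)) -ex (bigD1 v) //= ltr_wpDr //.
    by apply: sumr_ge0 => i _; rewrite mulr_ge0 // ltW.
  by rewrite mulr_gt0 // Af_gt0.
pose q := fnat f 1 (deg e v) * x v / r.
have xq w : e v w -> ~~ e u w -> w != u -> x w = q.
  move=> evw euw wu; have := ex w; rewrite (bigD1 v) //= big1 => [|t tv].
    rewrite addr0 AfE sym evw (pdeg w) // => h.
    by rewrite /q h mulrAC mulfV ?mul1r // gt_eqF.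
  rewrite AfE; case: ifP => [/(pend w t evw euw wu) tE|]; last by rewrite mul0r.
  by rewrite tE eqxx in tv.
have q0 : 0 < q by rewrite -(xq w1) //.
apply: (maximal_no_shift fP n6 ae pe me uv hY Y0 degY (or_introl euv) xvu w1u).
  by rewrite shift_uE // inE eqxx !andbF.
have w1v : w1 != v by exact: neq.
have w1Y : w1 \notin Y by rewrite inE eqxx !andbF.
rewrite (bigD1 w1) /=; last by rewrite evw1 euw1.
set D := _ - _.
have -> : D u w1 = 0.
  by rewrite /D !mxE shift_uE // (negPf w1Y) (negPf euw1) subrr.
have -> : D v w1 = fnat f 4 1 - fnat f (4 + #|Y|) 1.
  rewrite /D [LHS]mxE [X in _ + X]mxE !AfE shift_vE // w1Y evw1 dv4 dv.
  by rewrite deg_shift_other // pdeg.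
rewrite (eq_bigr (fun w => (fnat f (deg e u + #|Y|) 1 * x u - fnat f (4 + #|Y|) 1 * x v) * q)); last first.
  move=> w /andP[/andP[/andP[evw euw] wu] ww1].
  have wY : w \in Y by rewrite inE evw euw wu.
  rewrite (shift_Du_Y _ ge uv hY wY) (shift_Dv_Y _ ge uv hY wY) (pdeg w) // dv (xq w) //.
  by rewrite mulNr.
rewrite sumr_const (_ : #|_| = #|Y|); last first.
  by apply: eq_card => w; rewrite [RHS]inE unfold_in /= !andbA.
rewrite (xq w1) // mul0r add0r -mulrnAl -mulrDl mulr_ge0 //; last exact: ltW.
(* The edge [v w1] loses [g - f4], in units of [x v * q]. Each of the [#|Y|] moved edges gains at
   least [g' - g] in the same units, and together these gains cover the loss. *)
have cm := @fnat_convex_mul _ _ fP 4 #|Y| 1 isT isT.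
set F := fnat f (deg e u + #|Y|) 1; set f4 := fnat f 4 1 in cm *.
set g := fnat f (4 + #|Y|) 1 in cm *; set g' := fnat f (4 + #|Y|).+1 1 in cm.
have gF : g' <= F by apply: fnat_le; rewrite // -addSn leq_add2r.
have g0 : 0 < g' by exact: fnat_gt0.
have h1 : g' * x v <= F * x u by apply: ler_pM => //; exact: ltW.
rewrite -mulr_natl.
have y0 : 0 <= #|Y|%:R :> R by rewrite ler0n.
have h2 : #|Y|%:R * ((g' - g) * x v) <= #|Y|%:R * (F * x u - g * x v).
  by rewrite ler_wpM2l // mulrBl lerD2r.
apply: le_trans (lerD (lexx _) h2).
rewrite mulrA -mulrDl mulr_ge0 //; last exact: ltW.
by rewrite -opprB addrC subr_ge0.
Qed.

Lemma maximal_kelmans_stable : kelmans_stable e.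
Proof. by move=> u v a b; exact: (maximal_kelmans fP n6 ae pe me). Qed.

(** A vertex [c] of maximum degree has a vertex at distance 2, since it is not adjacent to all
    others. For the intermediate [v], maximality of the degree of [c] yields a private neighbour of
    [c] as well, so the classification of pairs applies. *)
Lemma maximal_structure : isomorphic e (B3 n) \/ isomorphic e (B4 n).
Proof.
have [_ con tot dle] := ae.
have n0 : (0 < n)%N by exact: leq_trans n6.
have kel := maximal_kelmans_stable.
have [c cmax] : exists c, forall i, (deg e i <= deg e c)%N.
  by case: (arg_maxnP (deg e) (isT : xpredT (Ordinal n0))) => c _ cm; exists c => i; exact: cm.
have [v [w [ecv evw ecw wc]]] : exists v w, [/\ e c v, e v w, ~~ e c w & w != c].
  apply: contrapT => H.
  pose S : pred 'I_n := [pred i | (i == c) || e c i].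
  have cl : fingraph.closed e S.
    apply: (intro_closed (sym_connect_sym sym)) => i j eij.
    rewrite !inE => /orP[/eqP ic|eci]; first by rewrite -ic eij orbT.
    apply: contraT; rewrite negb_or => /andP[jc ecj].
    by case: H; exists i, j.
  have all_S i : i != c -> e c i.
    by have := closed_connect cl (con c i); rewrite !inE eqxx => /esym/orP[->|].
  have := dle c; rewrite /deg (_ : [set j | e c j] = [set~ c]).
    by rewrite cardsC1 card_ord; lia.
  apply/setP => i; rewrite !inE; have [->|/all_S] := eqVneq i c; first by rewrite irr.
  by move=> ->.
have evc : e v c by rewrite sym.
(* Otherwise every neighbour of [c] except [v] is a neighbour of [v], and with [w] in addition [v]
   would have larger degree. *)
have [z [ecz evz zv]] : exists z, [/\ e c z, ~~ e v z & z != v].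
  apply: contrapT => H.
  have : (deg e c < deg e v)%N; last by rewrite ltnNge cmax.
  rewrite /deg (cardsD1 v) [X in (_ < X)%N](cardsD1 c) !inE ecv evc ltn_add2l.
  apply: proper_card; apply/properP; split.
    apply/fintype.subsetP => y; rewrite !inE => /andP[yv ecy].
    rewrite neq //=; apply: contraT => evy; by case: H; exists y.
  by exists w; rewrite !inE ?wc // negb_and ecw orbT.
have hz : [/\ e c z, ~~ e v z & z != v] by split.
have hw : [/\ e v w, ~~ e c w & w != c] by split.
have [|[a [b db]]] := pair_structure n6 ge tot kel ecv hz hw; first by right.
left.
have db' : double_broom e v c a b.
  case: db => [ab eca ecb K inner]; split; rewrite // 1?andbC //.
    by move=> y evy ecy; exact: K.
  by move=> i j ic iv jc jv; exact: inner.
have [[w' [evw' ecw' wc' ww']]|HW] := pselect (exists w',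
    [/\ e v w', ~~ e c w', w' != c & w' != w]); last first.
  apply: (double_broom_B3 ge kel ecv hz hw db) => y evy ecy yc.
  by apply/eqP; apply: contraT => yw; case: HW; exists y.
have [[z' [ecz' evz' zv' zz']]|HZ] := pselect (exists z',
    [/\ e c z', ~~ e v z', z' != v & z' != z]); last first.
  apply: (double_broom_B3 ge kel evc hw hz db') => y ecy evy yv.
  by apply/eqP; apply: contraT => yz; case: HZ; exists y.
exfalso.
have Hz t : t \in [:: z'; z] -> [/\ e c t, ~~ e v t & t != v].
  by rewrite !inE => /orP[]/eqP ->.
have Hw t : t \in [:: w'; w] -> [/\ e v t, ~~ e c t & t != c].
  by rewrite !inE => /orP[]/eqP ->.
have [xvc|/ltW xcv] := leP (x v) (x c).
  exact: (double_broom_not_maximal ecv db xvc zz' Hz ww' Hw).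
exact: (double_broom_not_maximal evc db' xcv ww' Hw zz' Hz).
Qed.

End MaximalStructure.

(** * Comparison of B4 and B3 *)

Section RealInequalities.
Context {R : realType}.
Variables (r x c w p f33 f32 F A g3 P C D m : R).

(** On the left is the form of [B4] at its Perron vector: [x] on the two degree-3 vertices of the
    diamond, [c] on the vertex with the pendants, [w] on the other degree-2 vertex, [p] on the
    pendants. On the right the same entries are placed on [B3]. The bound on [2 * g3] is convexity
    between degrees 2 and 4. *)
Lemma B4_B3_ineq_le : 0 <= x -> 0 <= c -> 0 <= w -> 0 <= p -> 0 <= f32 ->
  2 * g3 <= F + A -> P <= A -> f33 <= C -> f32 <= C -> f32 <= D -> w <= p ->
  2 * (f33 * x * x + 2 * g3 * c * x + 2 * f32 * x * w + (m + 1) * P * c * p) <=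
  2 * (F * c * x + A * c * (x + p) + C * x * (x + p) + D * x * w + m * P * c * p).
Proof.
move=> x0 c0 w0 p0 f0 hF hA hC hC2 hD wp.
have t1 : 0 <= (F + A - 2 * g3) * (c * x) by rewrite !mulr_ge0 ?subr_ge0.
have t2 : 0 <= (A - P) * (c * p) by rewrite !mulr_ge0 ?subr_ge0.
have t3 : 0 <= (C - f33) * (x * x) by rewrite !mulr_ge0 ?subr_ge0.
have t4 : 0 <= (C - f32) * (x * p) by rewrite !mulr_ge0 ?subr_ge0.
have t5 : 0 <= f32 * (x * (p - w)) by rewrite !mulr_ge0 ?subr_ge0.
have t6 : 0 <= (D - f32) * (x * w) by rewrite !mulr_ge0 ?subr_ge0.
move: t1 t2 t3 t4 t5 t6; clear; lra.
Qed.

(** The same comparison with [w] and [p] exchanged. The deficit [f32 * x * (w - p)] is now paid by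
    [A * c * (w - p)], which is why [x <= c] is required. *)
Lemma B4_B3_ineq_ge : 0 <= x -> 0 <= c -> 0 <= w -> 0 <= p -> 0 <= f32 ->
  2 * g3 <= F + A -> P <= A -> f33 <= C -> f32 <= C -> f32 <= D -> f32 <= A ->
  p <= w -> x <= c ->
  2 * (f33 * x * x + 2 * g3 * c * x + 2 * f32 * x * w + (m + 1) * P * c * p) <=
  2 * (F * c * x + A * c * (x + w) + C * x * (x + w) + D * x * p + m * P * c * p).
Proof.
move=> x0 c0 w0 p0 f0 hF hA hC hC2 hD hA2 pw xc.
have t1 : 0 <= (F + A - 2 * g3) * (c * x) by rewrite !mulr_ge0 ?subr_ge0.
have t2 : 0 <= (A - P) * (c * p) by rewrite !mulr_ge0 ?subr_ge0.
have t3 : 0 <= (C - f33) * (x * x) by rewrite !mulr_ge0 ?subr_ge0.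
have t4 : 0 <= (C - f32) * (x * w) by rewrite !mulr_ge0 ?subr_ge0.
have t5 : 0 <= (A - f32) * (c * (w - p)) by rewrite !mulr_ge0 ?subr_ge0.
have t6 : 0 <= f32 * ((c - x) * (w - p)) by rewrite !mulr_ge0 ?subr_ge0.
have t7 : 0 <= (D - f32) * (x * p) by rewrite !mulr_ge0 ?subr_ge0.
move: t1 t2 t3 t4 t5 t6 t7; clear; lra.
Qed.

(* If [c < x], the eigenvalue equations give [r ^ 2 (x - c) <= 2 f32 ^ 2 (x - c)],
   whereas [r ^ 2 x > r f32 w = 2 f32 ^ 2 x]. *)
Lemma B4_center_max : 0 < r -> 0 < x -> 0 < c -> 0 < w -> 0 < p -> 1 <= m ->
  0 < f33 -> 0 < f32 -> f33 <= g3 -> f32 <= P ->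
  r * x = f33 * x + g3 * c + f32 * w ->
  r * c = g3 * (x + x) + P * p + m * (P * p) ->
  r * w = f32 * (x + x) -> r * p = P * c -> x <= c.
Proof.
move=> r0 x0 c0 w0 p0 m1 f33_0 f32_0 hg hP ex ec ew ep.
have g0 : 0 < g3 by exact: lt_le_trans hg.
rewrite leNgt; apply/negP => cx.
have s1 : r * (x - c) <= f32 * w - (m + 1) * (P * p).
  have u1 : 0 <= g3 * (x - c) by rewrite mulr_ge0 ?subr_ge0 // ltW.
  have u2 : 0 <= (g3 - f33) * x by rewrite mulr_ge0 ?subr_ge0 // ltW.
  by rewrite mulrBr ex ec; move: u1 u2; lra.
have s2 : r * (r * (x - c)) <= 2 * f32 ^+ 2 * x - (m + 1) * (P ^+ 2 * c).
  have -> : 2 * f32 ^+ 2 * x - (m + 1) * (P ^+ 2 * c) =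
      r * (f32 * w - (m + 1) * (P * p)).
    transitivity (f32 * (r * w) - (m + 1) * P * (r * p)); last by ring.
    by rewrite ew ep; ring.
  by rewrite ler_pM2l.
have s3 : 2 * f32 ^+ 2 * c <= (m + 1) * (P ^+ 2 * c).
  have sq : f32 ^+ 2 <= P ^+ 2 by rewrite ler_pXn2r // nnegrE ltW // (lt_le_trans f32_0).
  rewrite -mulrA; apply: ler_pM => //; first by rewrite mulr_ge0 ?sqr_ge0 // ltW.
    by move: m1; lra.
  by rewrite ler_pM2r.
have s4 : 0 < (r ^+ 2 - 2 * f32 ^+ 2) * x.
  have -> : (r ^+ 2 - 2 * f32 ^+ 2) * x = r * (r * x) - f32 * (r * w).
    by rewrite ew; ring.
  have -> : r * (r * x) - f32 * (r * w) = r * (f33 * x + g3 * c) by rewrite ex; ring.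
  by rewrite mulr_gt0 // addr_gt0 // mulr_gt0.
rewrite pmulr_lgt0 // in s4.
have s5 : 0 < (r ^+ 2 - 2 * f32 ^+ 2) * (x - c) by rewrite mulr_gt0 // subr_gt0.
by move: s2 s3 s5; lra.
Qed.

End RealInequalities.

(** * Eigenvector equations and quadratic forms in explicit coordinates *)

Section B4B3.
Context {R : realType} (f : R -> R -> R).
Hypothesis fP : propP f.
Context (m : nat).

Lemma big_ord5 (T : Type) (idx : T) (op : T -> T -> T) (s : 'I_m.+4.+1 -> T)
    (F : nat -> T) : (forall i, s i = F i) -> \big[op/idx]_i s i =
  op (F 0%N) (op (F 1%N) (op (F 2%N) (op (F 3%N) (op (F 4%N)
    (\big[op/idx]_(i < m) F i.+4.+1))))).
Proof. by move=> sF; rewrite (eq_bigr _ (fun i _ => sF i)) !big_ord_recl. Qed.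

Lemma deg_sum n (e : rel 'I_n) i : deg e i = (\sum_j e i j)%N.
Proof.
by rewrite /deg -sum1_card big_mkcond; apply: eq_bigr => j _; rewrite inE; case: (e i j).
Qed.

Definition B3_adj i j := [|| diamond_adj i j, (i == 1) && (j == 4) | (i == 0) && (5 <= j)]%N.
Definition B4_adj i j := diamond_adj i j || (i == 2)%N && (4 <= j)%N.
(** The default 1 of [nth] is the degree of the pendant vertices. Below, the default likewise is the
    common value on all vertices beyond the list. *)
Definition B3_deg i := nth 1%N [:: m + 3; 4; 2; 2]%N i.
Definition B4_deg i := nth 1%N [:: 3; 3; m + 3; 2]%N i.

Lemma deg_B3 i : deg (B3 m.+4.+1) i = B3_deg i.
Proof.
rewrite deg_sum (big_ord5 _ _ (F := fun j => nat_of_bool (B3_adj i j || B3_adj j i))) //.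
case: i => -[|[|[|[|[|i]]]]] hi; rewrite /B3_adj /B3_deg /= ?nth_nil ?big1_eq //.
by rewrite sum1_card card_ord; lia.
Qed.

Lemma deg_B4 i : deg (B4 m.+4.+1) i = B4_deg i.
Proof.
rewrite deg_sum (big_ord5 _ _ (F := fun j => nat_of_bool (B4_adj i j || B4_adj j i))) //.
case: i => -[|[|[|[|[|i]]]]] hi; rewrite /B4_adj /B4_deg /= ?nth_nil ?big1_eq //.
by rewrite sum1_card card_ord; lia.
Qed.

Definition vec5 (x0 x1 x2 x3 x4 p : R) (i : 'I_m.+4.+1) := nth p [:: x0; x1; x2; x3; x4] i.

Lemma sqnorm_vec5 x0 x1 x2 x3 x4 p : sqnorm (vec5 x0 x1 x2 x3 x4 p) =
  x0 ^+ 2 + x1 ^+ 2 + x2 ^+ 2 + x3 ^+ 2 + x4 ^+ 2 + m%:R * p ^+ 2.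
Proof.
rewrite /sqnorm (big_ord5 _ _ (F := fun j => nth p [:: x0; x1; x2; x3; x4] j ^+ 2)) //=.
rewrite (eq_bigr (fun=> p ^+ 2)); last by move=> i _; rewrite nth_nil.
by rewrite sumr_const card_ord -[_ *+ m]mulr_natl; ring.
Qed.

Lemma row_vec5 (e : rel 'I_m.+4.+1) (a : nat -> nat -> bool) (d : nat -> nat)
    (x0 x1 x2 x3 x4 p : R) (i : 'I_m.+4.+1) :
  (forall i j, e i j = a i j || a j i) -> (forall i, deg e i = d i) ->
  let w j := if a i j || a j i then fnat f (d i) (d j) else 0 in
  \sum_j Af f e i j * vec5 x0 x1 x2 x3 x4 p j =
  w 0%N * x0 + (w 1%N * x1 + (w 2%N * x2 + (w 3%N * x3 + (w 4%N * x4 +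
    \sum_(j < m) w j.+4.+1 * p)))).
Proof.
move=> ea ed w; rewrite (big_ord5 _ _ (F := fun j => w j * nth p [:: x0; x1; x2; x3; x4] j)).
  by under eq_bigr => j _ do rewrite /= nth_nil.
by move=> j; rewrite AfE ea !ed.
Qed.

Let N := (m + 3)%N.
Let sum0 (p : R) : \sum_(j < m) 0 * p = 0.
Proof. by rewrite big1 // => j _; rewrite mul0r. Qed.
Let sumc (a : R) : \sum_(j < m) a = m%:R * a.
Proof. by rewrite sumr_const card_ord mulr_natl. Qed.

Lemma row_B3 x0 x1 x2 x3 x4 p i :
  \sum_j Af f (B3 m.+4.+1) i j * vec5 x0 x1 x2 x3 x4 p j =
  nth (fnat f N 1 * x0) [:: fnat f N 4 * x1 + fnat f N 2 * (x2 + x3) + m%:R * (fnat f N 1 * p);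
   fnat f N 4 * x0 + fnat f 4 2 * (x2 + x3) + fnat f 4 1 * x4;
   fnat f N 2 * x0 + fnat f 4 2 * x1; fnat f N 2 * x0 + fnat f 4 2 * x1;
   fnat f 4 1 * x1] i.
Proof.
have N0 : (0 < N)%N by rewrite /N addn3.
rewrite (@row_vec5 _ B3_adj B3_deg) //; last exact: deg_B3.
case: i => -[|[|[|[|[|i]]]]] hi; rewrite /B3_adj /B3_deg -/N /= ?nth_nil ?sum0 ?sumc
  ?(fnatC fP _ N0) // ?(fnatC fP _ (isT : 0 < 4)%N) //; ring.
Qed.

Lemma row_B4 x0 x1 x2 x3 x4 p i :
  \sum_j Af f (B4 m.+4.+1) i j * vec5 x0 x1 x2 x3 x4 p j =
  nth (fnat f N 1 * x2) [:: fnat f 3 3 * x1 + fnat f N 3 * x2 + fnat f 3 2 * x3;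
   fnat f 3 3 * x0 + fnat f N 3 * x2 + fnat f 3 2 * x3;
   fnat f N 3 * (x0 + x1) + fnat f N 1 * x4 + m%:R * (fnat f N 1 * p);
   fnat f 3 2 * (x0 + x1);
   fnat f N 1 * x2] i.
Proof.
have N0 : (0 < N)%N by rewrite /N addn3.
rewrite (@row_vec5 _ B4_adj B4_deg) //; last exact: deg_B4.
case: i => -[|[|[|[|[|i]]]]] hi; rewrite /B4_adj /B4_deg -/N /= ?nth_nil ?sum0 ?sumc
  ?(fnatC fP _ N0) // ?(fnatC fP (isT : 0 < 2)%N (isT : 0 < 3)%N) //; ring.
Qed.

Lemma qform_B3 x0 x1 x2 x3 x4 p :
  qform (Af f (B3 m.+4.+1)) (vec5 x0 x1 x2 x3 x4 p) =
  2 * (fnat f N 4 * x0 * x1 + fnat f N 2 * x0 * (x2 + x3) +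
    fnat f 4 2 * x1 * (x2 + x3) + fnat f 4 1 * x1 * x4 + m%:R * fnat f N 1 * x0 * p).
Proof.
have -> : qform (Af f (B3 m.+4.+1)) (vec5 x0 x1 x2 x3 x4 p) =
    \sum_i vec5 x0 x1 x2 x3 x4 p i *
      \sum_j Af f (B3 m.+4.+1) i j * vec5 x0 x1 x2 x3 x4 p j.
  apply: eq_bigr => i _; rewrite mulr_sumr; apply: eq_bigr => j _; ring.
under eq_bigr => i _ do rewrite row_B3 /vec5.
rewrite (big_ord5 _ _ (F := fun i => nth p [:: x0; x1; x2; x3; x4] i *
  nth (fnat f N 1 * x0) [:: fnat f N 4 * x1 + fnat f N 2 * (x2 + x3) + m%:R * (fnat f N 1 * p);
   fnat f N 4 * x0 + fnat f 4 2 * (x2 + x3) + fnat f 4 1 * x4;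
   fnat f N 2 * x0 + fnat f 4 2 * x1; fnat f N 2 * x0 + fnat f 4 2 * x1;
   fnat f 4 1 * x1] i)) //=.
rewrite (eq_bigr (fun=> p * (fnat f N 1 * x0))); last by move=> i _; rewrite !nth_nil.
rewrite sumc; ring.
Qed.

Lemma B4_simple : simple_graph (B4 m.+4.+1).
Proof.
split=> [i|i j]; last by rewrite /B4 /sym_rel orbC.
by case: i => -[|[|[|i]]] hi.
Qed.

Lemma B4_connected : connected_graph (B4 m.+4.+1).
Proof.
have [_ sym] := B4_simple.
pose c : 'I_m.+4.+1 := Ordinal (isT : (2 < m.+4.+1)%N).
pose u : 'I_m.+4.+1 := Ordinal (isT : (0 < m.+4.+1)%N).
have H i : connect (B4 m.+4.+1) i c.
  case: i => -[|[|[|[|i]]]] hi; try by apply: connect1.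
    by rewrite (_ : Ordinal hi = c) //; exact: val_inj.
  by apply: (@connect_trans _ _ u); apply: connect1.
move=> i j; apply: connect_trans (H i) _.
by rewrite (sym_connect_sym sym).
Qed.

(** The eigenvalue equation at a pendant vertex determines its entry from [c], so all pendant
    entries agree; the two degree-3 vertices of the diamond agree by symmetry. *)
Lemma B4_perron r y : perron_pair f (B4 m.+4.+1) r y -> exists x c w p,
  [/\ y = vec5 x x c w p p, [/\ 0 < r, 0 < x, 0 < c, 0 < w & 0 < p],
   r * x = fnat f 3 3 * x + fnat f N 3 * c + fnat f 3 2 * w,
   r * c = fnat f N 3 * (x + x) + fnat f N 1 * p + m%:R * (fnat f N 1 * p) &
   r * w = fnat f 3 2 * (x + x) /\ r * p = fnat f N 1 * c].
Proof.
move=> [y0 ey _]; have [irr sym] := B4_simple.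
have N0 : (0 < N)%N by rewrite /N addn3.
pose o k : 'I_m.+4.+1 := inord k.
have r0 : 0 < r.
  rewrite -(pmulr_lgt0 _ (y0 (o 0%N))) -ey (bigD1 (o 1%N)) //= ltr_wpDr //.
    by apply: sumr_ge0 => i _; rewrite mulr_ge0 ?Af_ge0 // ltW.
  by rewrite mulr_gt0 // Af_gt0 // /B4 /sym_rel !inordK.
pose x0 := y (o 0%N); pose x1 := y (o 1%N).
pose c := y (o 2%N); pose w := y (o 3%N); pose p := fnat f N 1 * c / r.
have yE : y = vec5 x0 x1 c w p p.
  apply/funext => i; rewrite /vec5.
  have [i4|i4] := ltnP i 4.
    by case: i i4 => -[|[|[|[|i]]]] hi //= _; rewrite /x0 /x1 /c /w; congr y; apply: val_inj; rewrite /= inordK.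
  have -> : nth p [:: x0; x1; c; w; p] i = p.
    by case: i i4 => -[|[|[|[|[|i]]]]] hi //= _; rewrite nth_nil.
  have := ey i; rewrite (bigD1 (o 2%N)) //= big1 => [|j j2].
    rewrite addr0 AfE !deg_B4 inordK // => h.
    apply: (mulfI (lt0r_neq0 r0)); rewrite -h /p mulrCA mulfV ?lt0r_neq0 // mulr1.
    rewrite /B4 /sym_rel inordK //.
    by case: i i4 {h} => -[|[|[|[|[|i]]]]] hi //= _; rewrite /B4_deg /= ?nth_nil fnatC.
  rewrite AfE; case: ifP => [|_]; last by rewrite mul0r.
  have {}j2 : val j != 2%N by apply: contra j2 => /eqP j2; apply/eqP/val_inj; rewrite /= inordK.
  rewrite /B4 /sym_rel.
  by case: i i4 => -[|[|[|[|i]]]] hi //= _; case: j j2 => -[|[|[|[|j]]]] hj.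
have row k := etrans (esym (row_B4 x0 x1 c w p p (o k)))
  (etrans (congr1 (fun z => \sum_j Af f (B4 m.+4.+1) (o k) j * z j) (esym yE)) (ey (o k))).
have e0 := row 0%N; have e1 := row 1%N; have e2 := row 2%N.
have e3 := row 3%N; have e4 := row 4%N.
rewrite yE /vec5 !inordK //= in e0 e1 e2 e3 e4.
have f33 : 0 < fnat f 3 3 by exact: fnat_gt0.
have x01 : x0 = x1.
  (* Subtracting the equations at the two vertices leaves only the edge between them, with a
     negative sign. *)
  apply/eqP; rewrite -subr_eq0; have : (r + fnat f 3 3) * (x0 - x1) = 0.
    by rewrite mulrBr !mulrDl -e0 -e1; ring.
  by move/eqP; rewrite mulf_eq0 gt_eqF // addr_gt0.
exists x0, c, w, p; split; rewrite -?e0 -?e2 -?e3 -?e4 -?x01 //.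
  by rewrite {1}yE -x01.
split=> //; rewrite /x0 /c /w //.
by apply: divr_gt0 => //; apply: mulr_gt0; [exact: fnat_gt0 | exact: y0].
Qed.

Lemma B4_le_B3 r4 r3 : (0 < m)%N -> largest_eigenvalue (Af f (B4 m.+4.+1)) r4 ->
  largest_eigenvalue (Af f (B3 m.+4.+1)) r3 -> r4 <= r3.
Proof.
move=> m0 l4 l3.
have [s4 c4] := (B4_simple, B4_connected).
have n0 : (0 < m.+4.+1)%N by [].
have [r [y py]] := perron_exists fP n0 s4 c4.
have -> : r4 = r.
  exact: (largest_eigenvalue_unique l4 (perron_largest fP n0 s4.2 py)).
have s3 : symmetric (B3 m.+4.+1) by move=> i j; rewrite /B3 /sym_rel orbC.
(* Only the largest eigenvalue [r3] is given. The Rayleigh maximum is itself an eigenvalue, hence at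
   most [r3]. *)
have q3 z : qform (Af f (B3 m.+4.+1)) z <= r3 * sqnorm z.
  have [r' [z' [nz ez' mz]]] := qform_le_max (Af_tr fP s3).
  have er' : eigenvalue (Af f (B3 m.+4.+1)) r'.
    by apply/(eigenvalue_is_eigen r' (Af_tr fP s3)); exists z'.
  by apply: le_trans (mz z) _; rewrite ler_wpM2r ?sqnorm_ge0 // l3.2.
have [x [c [w [p [yE [r0 x0 c0 w0 p0] ex ec [ew ep]]]]]] := B4_perron py.
have nN : (4 <= N)%N by rewrite /N addn3.
have N0 : (0 < N)%N by exact: leq_trans nN.
have hF : 2 * fnat f N 3 <= fnat f N 4 + fnat f N 2.
  have := @fnat_convex _ _ fP 2 3 1 N isT N0 isT.
  by rewrite !(fnatC fP _ N0) // => h; lra.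
have hAP : fnat f N 1 <= fnat f N 2 by rewrite !(fnatC fP N0) //; exact: fnat_le.
have hPD : fnat f 4 1 <= fnat f N 1 by exact: fnat_le.
have hD : fnat f 3 2 <= fnat f 4 1 by exact: fnat_spread.
have hC : fnat f 3 3 <= fnat f 4 2 by exact: fnat_spread.
have hC2 : fnat f 3 2 <= fnat f 4 2 by exact: fnat_le.
have hA : fnat f 3 2 <= fnat f N 2 by apply: fnat_le => //; exact: leq_trans nN.
have h3 : fnat f 3 3 <= fnat f N 3 by apply: fnat_le => //; exact: leq_trans nN.
have p32 : 0 < fnat f 3 2 by exact: fnat_gt0.
have p33 : 0 < fnat f 3 3 by exact: fnat_gt0.
have m1 : 1 <= m%:R :> R by rewrite ler1n.
have qE : r * sqnorm y = 2 * (fnat f 3 3 * x * x + 2 * fnat f N 3 * c * x +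
    2 * fnat f 3 2 * x * w + (m%:R + 1) * fnat f N 1 * c * p).
  rewrite yE sqnorm_vec5.
  transitivity (2 * x * (r * x) + c * (r * c) + w * (r * w) + (m%:R + 1) * p * (r * p)).
    by ring.
  by rewrite ex ec ew ep; ring.
suff [z zn zq] : exists2 z, sqnorm z = sqnorm y &
    r * sqnorm y <= qform (Af f (B3 m.+4.+1)) z.
  have sy : 0 < sqnorm y.
    by case: py => y0 _ _; apply: (@sqnorm_gt0 _ _ y ord0); rewrite gt_eqF.
  by rewrite -(ler_pM2r sy) (le_trans zq) // -zn.
rewrite {}qE yE sqnorm_vec5.
(* On [B3], the vertices [u], [v], [a] receive [c], [x], [x]. The larger of [w] and [p] goes to the
   degree-2 vertex [b], the smaller to the pendant vertex at [v]. *)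
have [wp|/ltW pw] := leP w p.
  exists (vec5 c x x p w p); first by rewrite sqnorm_vec5; ring.
  by rewrite qform_B3; apply: B4_B3_ineq_le => //; exact: ltW.
exists (vec5 c x x w p p); first by rewrite sqnorm_vec5; ring.
rewrite qform_B3; apply: B4_B3_ineq_ge => //; try exact: ltW.
apply: (@B4_center_max _ r x c w p (fnat f 3 3) (fnat f 3 2) (fnat f N 3) (fnat f N 1) m%:R) => //.
exact: le_trans hPD.
Qed.

End B4B3.

(** * Dominating vertices *)

Definition deg_off n (e : rel 'I_n) c y := #|[set t | e y t && (t != c)]|.

Section DominatingVertex.
Context {n : nat} (e : rel 'I_n) (c : 'I_n).
Hypothesis n6 : (6 <= n)%N.
Hypothesis ge : simple_graph e.
Hypothesis tot : (\sum_i deg e i = 2 * n.+1)%N.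
Hypothesis dc : (n - 2 < deg e c)%N.

Let irr := ge.1.
Let sym := ge.2.
Let neq i j : e i j -> i != j.
Proof. by move=> eij; apply/eqP => ij; rewrite ij irr in eij. Qed.

Let ecE y : y != c -> e c y.
Proof.
move=> yc; have : [set j | e c j] == [set~ c].
  rewrite eqEcard cardsC1 card_ord; apply/andP; split.
    by apply/fintype.subsetP => j; rewrite !inE => /neq; rewrite eq_sym.
  by move: dc n6; rewrite /deg; lia.
by move/eqP/setP/(_ y); rewrite !inE yc.
Qed.

Local Notation inner := (deg_off e c).

(** Of the n + 1 edges, n - 1 are incident with [c]; the two others are counted at both ends. They
    share an endpoint in [B1] and are disjoint in [B2]. *)
Let sum_inner : (\sum_(y | y != c) inner y = 4)%N.
Proof.
have dcE : deg e c = n.-1.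
  rewrite /deg (_ : [set j | e c j] = [set~ c]) ?cardsC1 ?card_ord //.
  apply/setP => j; rewrite !inE; have [->|/ecE ->//] := eqVneq j c.
  by rewrite irr.
have dy y : y != c -> deg e y = (1 + inner y)%N.
  move=> yc; rewrite /deg (cardsD1 c) !inE sym ecE //; congr addn.
  by apply: eq_card => t; rewrite !inE andbC.
have cnt : (\sum_(y | y != c) 1 = n.-1)%N.
  have : (\sum_(y : 'I_n) 1 = n)%N by rewrite sum1_card card_ord.
  by rewrite (bigD1 c) //=; lia.
have := tot; rewrite (bigD1 c) //= dcE (eq_bigr _ dy) big_split /= cnt.
rewrite addnA => h; apply/eqP; rewrite -(eqn_add2l (n.-1 + n.-1)) h; move: n6; clear; lia.
Qed.

Let inner_le s : uniq s -> all (fun y => y != c) s -> (\sum_(y <- s) inner y <= 4)%N.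
Proof. by move=> us sP; rewrite -sum_inner; exact: sum_uniq_le. Qed.

Let inner_ge y s : uniq s -> all (fun t => e y t && (t != c)) s -> (size s <= inner y)%N.
Proof.
move=> us /allP es; rewrite -(card_uniqP us); apply: subset_leq_card.
by apply/fintype.subsetP => t /es; rewrite inE.
Qed.

(** The path [a], [y], [b] contributes 1 + 2 + 1 = 4 and thus accounts for all edges avoiding
    [c]. *)
Lemma dominating_B1 y a b : y != c -> a != c -> b != c -> a != b -> e y a -> e y b ->
  isomorphic e (B1 n).
Proof.
move=> yc ac bc ab eya eyb.
have [eay eby] : e a y /\ e b y by rewrite !(sym _ y).
have [ya yb] := (neq eya, neq eyb).
have gy s : uniq (a :: b :: s) -> all (fun t => e y t && (t != c)) s ->
    (size s + 2 <= inner y)%N.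
  by move=> us es; have := @inner_ge y _ us; rewrite /= eya eyb ac bc es addn2; exact.
have ga s : uniq (y :: s) -> all (fun t => e a t && (t != c)) s -> (size s + 1 <= inner a)%N.
  by move=> us es; have := @inner_ge a _ us; rewrite /= eay yc es addn1; exact.
have gb s : uniq (y :: s) -> all (fun t => e b t && (t != c)) s -> (size s + 1 <= inner b)%N.
  by move=> us es; have := @inner_ge b _ us; rewrite /= eby yc es addn1; exact.
have gy0 : (2 <= inner y)%N.
  by apply: (gy [::]); rewrite //= inE ab.
have ga0 : (1 <= inner a)%N by exact: (ga [::]).
have gb0 : (1 <= inner b)%N by exact: (gb [::]).
have le s : uniq (y :: a :: b :: s) -> all (fun y => y != c) s ->
    (inner y + (inner a + (inner b + \sum_(y <- s) inner y)) <= 4)%N.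
  by move=> us es; have := inner_le us; rewrite /= yc ac bc es !big_cons; exact.
have le0 : (inner y + (inner a + inner b) <= 4)%N.
  by have := le [::]; rewrite /= !inE negb_or ya yb ab big_nil addn0; exact.
have eab : ~~ e a b.
  apply/negP => eab; have := ga [:: b]; rewrite /= inE yb eab bc => /(_ isT isT).
  by move: le0 gy0 gb0; clear; lia.
have hO t : t \notin [:: c; y; a; b] -> [/\ t != c, ~~ e y t, ~~ e a t, ~~ e b t &
    inner t = 0%N].
  rewrite !inE !negb_or => /and4P[tc ty ta tb]; split=> //.
  - apply/negP => eyt; have := gy [:: t]; rewrite /= !inE !negb_or ab !(eq_sym _ t) ta tb eyt tc.
    by move=> /(_ isT isT); move: le0 ga0 gb0; clear; lia.
  - apply/negP => eat; have := ga [:: t]; rewrite /= !inE (eq_sym _ t) ty eat tc.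
    by move=> /(_ isT isT); move: le0 gy0 gb0; clear; lia.
  - apply/negP => ebt; have := gb [:: t]; rewrite /= !inE (eq_sym _ t) ty ebt tc.
    by move=> /(_ isT isT); move: le0 gy0 ga0; clear; lia.
  - have := le [:: t]; rewrite /= !inE !negb_or ya yb ab !(eq_sym _ t) ty ta tb tc.
    by rewrite big_cons big_nil => /(_ isT isT); move: gy0 ga0 gb0; clear; lia.
apply: (@iso_of_pairs _ _ _ c [:: c; y; a; b]
  (fun i j => diamond_adj i j || (i == 0)%N && (4 <= j)%N)) => //.
- by rewrite /= !inE !negb_or !(eq_sym c) yc ac bc ya yb ab.
- by case=> [|[|[|[|[|k]]]]].
- by move=> [|[|[|[|k]]]] [|[|[|[|l]]]] /andP[] //= _ _;
    rewrite ?(ecE yc) ?(ecE ac) ?(ecE bc) ?eya ?eyb ?(negPf eab).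
- move=> [|[|[|[|k]]]] [|[|[|[|l]]]] // t _ _ tl; have [h1 h2 h3 h4 _] := hO t tl => /=.
  + exact: ecE.
  + exact: negPf.
  + exact: negPf.
  + exact: negPf.
- move=> [|[|[|[|k]]]] [|[|[|[|l]]]] // s t _ _ sl tl.
  have [sc _ _ _ s0] := hO s sl; have [tc _ _ _ _] := hO t tl.
  apply/negbTE/negP => est.
  by have := @inner_ge s [:: t]; rewrite /= est tc s0 => /(_ isT isT).
Qed.

Lemma dominating_B2 : (forall y a b, y != c -> a != c -> b != c -> e y a -> e y b -> a = b) ->
  isomorphic e (B2 n).
Proof.
move=> U.
have le1 y : y != c -> (inner y <= 1)%N.
  move=> yc; rewrite leqNgt; apply/negP => /card_gt1P[a [b [ha hb]]].
  move: ha hb; rewrite !inE => /andP[eya ac] /andP[eyb bc].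
  by rewrite (U y a b) // eqxx.
have ex y : inner y != 0%N -> exists t, e y t /\ t != c.
  by rewrite -lt0n => /card_gt0P[t]; rewrite inE => /andP[]; exists t.
have [x [xc [y [exy yc]]]] : exists x, x != c /\ exists y, e x y /\ y != c.
  apply: contrapT => H; have := sum_inner; rewrite big1 // => x xc.
  apply/eqP; apply: contraT => /ex[y hy].
  by case: H; exists x; split=> //; exists y.
have eyx : e y x by rewrite sym.
have xy := neq exy.
(* The edge [x y] accounts for only 2 of the total 4, so some other vertex has a neighbour besides
   [c]. *)
have [z [zc zx zy [t [ezt tc]]]] : exists z, [/\ z != c, z != x, z != y &
    exists t, e z t /\ t != c].
  apply: contrapT => H; have := sum_inner.
  rewrite (bigD1 x) //= (bigD1 y) /=; last by rewrite yc eq_sym.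
  rewrite big1 => [|z /andP[/andP[zc zx] zy]]; last first.
    apply/eqP; apply: contraT => /ex h.
    by case: H; exists z; split.
  by move: (le1 x xc) (le1 y yc); clear; lia.
have etz : e t z by rewrite sym.
have zt := neq ezt.
have xt : x != t.
  by apply/eqP => xt; move: zy; rewrite (U x z y) ?eqxx // xt.
have yt : y != t.
  by apply/eqP => yt; move: zx; rewrite (U y z x) ?eqxx // yt.
have g0 i j : e i j -> j != c -> (0 < inner i)%N.
  by move=> eij jc; apply: (@inner_ge i [:: j]); rewrite /= ?eij ?jc.
have [gx gy gz gt] := And4 (g0 x y exy yc) (g0 y x eyx xc) (g0 z t ezt tc) (g0 t z etz zc).
have hO s : s \notin [:: c; x; y; z; t] -> s != c /\ forall q, q != c -> ~~ e s q.
  rewrite !inE !negb_or => /and5P[sc sx sy sz st]; split=> // q qc; apply/negP => esq.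
  have := @inner_le [:: s; x; y; z; t]; rewrite /= !inE !negb_or sx sy sz st xy.
  rewrite !(eq_sym _ z) zx zy xt yt zt sc xc yc zc tc !big_cons big_nil => /(_ isT isT).
  by move: gx gy gz gt (g0 s q esq qc); clear; lia.
have N i j k : i != c -> j != c -> k != c -> e i j -> j != k -> e i k = false.
  by move=> ic jc kc eij jk; apply/negP => eik; move: jk; rewrite (U i j k) ?eqxx.
apply: (@iso_of_pairs _ _ _ c [:: c; x; y; z; t] (fun i j => [|| (i == 0) && (j == 1),
    (i == 0) && (j == 2), (i == 1) && (j == 2), (i == 0) && (j == 3), (i == 0) && (j == 4),
    (i == 3) && (j == 4) | (i == 0) && (5 <= j)]%N)) => //.
- by rewrite /= !inE !negb_or !(eq_sym c) xc yc zc tc xy !(eq_sym _ z) zx zy xt yt zt.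
- by case=> [|[|[|[|[|k]]]]].
- have [yz xz] : y != z /\ x != z by rewrite !(eq_sym _ z).
  have exz : e x z = false by exact: (N x y).
  have ext : e x t = false by exact: (N x y).
  have eyz : e y z = false by exact: (N y x).
  have eyt : e y t = false by exact: (N y x).
  have [ecx ecy ecz ect] := And4 (ecE xc) (ecE yc) (ecE zc) (ecE tc).
  by move=> [|[|[|[|[|k]]]]] [|[|[|[|[|l]]]]] /andP[] //= _ _.
- move=> [|[|[|[|[|k]]]]] [|[|[|[|[|l]]]]] // s _ _ sl; have [sc h] := hO s sl => /=;
    by rewrite ?ecE // sym (negPf (h _ _)).
- move=> [|[|[|[|[|k]]]]] [|[|[|[|[|l]]]]] // s q _ _ sl ql.
  have [_ h] := hO s sl; have [qc _] := hO q ql.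
  by rewrite (negPf (h q qc)).
Qed.

Lemma dominating_B1_B2 : isomorphic e (B1 n) \/ isomorphic e (B2 n).
Proof.
have [H|H] := pselect (exists y a b, [/\ y != c, a != c, b != c, a != b & e y a /\ e y b]).
  by case: H => y [a [b [yc ac bc ab [eya eyb]]]]; left; exact: (dominating_B1 yc ac bc ab).
right; apply: dominating_B2 => y a b yc ac bc eya eyb.
by apply/eqP; apply: contraT => ab; case: H; exists y, a, b.
Qed.

End DominatingVertex.

(** * Existence of a maximiser and conclusion *)

Lemma maximal_admissible (R : realType) (f : R -> R -> R) n : propP f -> (0 < n)%N ->
  (exists e : rel 'I_n, admissible e) ->
  exists (e : rel 'I_n) r, [/\ admissible e, largest_eigenvalue (Af f e) r &
    forall (e' : rel 'I_n) r', admissible e' -> largest_eigenvalue (Af f e') r' -> r' <= r].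
Proof.
move=> fP n0 [e0 ae0].
(* Relations are encoded as finite functions so that the maximum runs over a finite type. The chosen
   value [F] is meaningful on admissible graphs only. *)
pose graph_of (g : {ffun 'I_n * 'I_n -> bool}) : rel 'I_n := fun i j => g (i, j).
have graphK (e : rel 'I_n) : graph_of [ffun p => e p.1 p.2] = e.
  by apply/funext => i; apply/funext => j; rewrite /graph_of ffunE.
have ex g : exists r, admissible (graph_of g) -> largest_eigenvalue (Af f (graph_of g)) r.
  have [[ge ce _ _]|na] := pselect (admissible (graph_of g)); last by exists 0.
  have [r [x px]] := perron_exists fP n0 ge ce.
  by exists r => _; exact: (perron_largest fP n0 ge.2 px).
have [F FP] := boolp.choice ex.
pose P : pred {ffun 'I_n * 'I_n -> bool} := fun g => `[< admissible (graph_of g) >].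
have P0 : P [ffun p => e0 p.1 p.2] by apply/asboolP; rewrite graphK.
have [g /asboolP ag gmax] := @Order.TotalTheory.arg_maxP _ _ _ _ P F P0.
exists (graph_of g), (F g); split=> //; first exact: FP.
move=> e' r' ae' le'.
have Pe' : P [ffun p => e' p.1 p.2] by apply/asboolP; rewrite graphK.
apply: le_trans (gmax _ Pe').
have := FP [ffun p => e' p.1 p.2]; rewrite graphK => /(_ ae') h.
by rewrite (largest_eigenvalue_unique le' h).
Qed.

Theorem theorem5p1 (R : realType) (f : R -> R -> R) (n : nat) (e : rel 'I_n)
    (rG rB3 : R) :
  propP f -> (6 <= n)%N -> bicyclic e ->
  ~ isomorphic e (B1 n) -> ~ isomorphic e (B2 n) ->
  ~ isomorphic e (B3 n) -> ~ isomorphic e (B4 n) ->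
  largest_eigenvalue (Af f e) rG ->
  largest_eigenvalue (Af f (B3 n)) rB3 ->
  rG < rB3.
Proof.
move=> fP n6 [ge [ce ne]] nB1 nB2 nB3 nB4 lG lB3.
have n0 : (0 < n)%N by exact: leq_trans n6.
have tot : (\sum_i deg e i = 2 * n.+1)%N by rewrite sum_deg // ne.
have ae : admissible e.
  split=> // i; rewrite leqNgt; apply/negP => di.
  by case: (dominating_B1_B2 n6 ge tot di).
have [M [r [aM lM mM]]] := maximal_admissible fP n0 (ex_intro _ e ae).
(* Stated for every graph attaining [r], not just for [M]: applied to [e] it gives the strict
   inequality, applied to [M] it identifies the maximum. *)
have struct (e' : rel 'I_n) : admissible e' -> largest_eigenvalue (Af f e') r ->
    isomorphic e' (B3 n) \/ isomorphic e' (B4 n).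
  move=> ae' le'; have [ge' ce' _ _] := ae'.
  have [r' [x px]] := perron_exists fP n0 ge' ce'.
  have rr := largest_eigenvalue_unique (perron_largest fP n0 ge'.2 px) le'.
  by rewrite rr in px; exact: (maximal_structure fP n6 ae' px mM).
have rGr : rG < r.
  rewrite lt_neqAle (mM _ _ ae lG) andbT; apply/eqP => rE.
  by rewrite rE in lG; case: (struct e ae lG).
apply: lt_le_trans rGr _.
have sM : symmetric M by case: aM => -[].
have sB3 : symmetric (B3 n) by move=> i j; rewrite /B3 /sym_rel orbC.
have sB4 : symmetric (B4 n) by move=> i j; rewrite /B4 /sym_rel orbC.
case: (struct M aM lM) => [iso|iso].
  by rewrite (largest_eigenvalue_unique lB3 (largest_eigenvalue_iso fP sM sB3 iso lM)).
have := largest_eigenvalue_iso fP sM sB4 iso lM; move: lB3; clear -n6 fP.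
case: n n6 => [|[|[|[|[|m]]]]] // n6 lB3 lB4.
exact: (B4_le_B3 fP _ lB4 lB3).
Qed.
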